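(* Let $\mathbb K$ be a field and let $A$ be one of the following algebras over $\mathbb K$: (1) the polynomial algebra $\mathbb K[x_1,\ldots,x_n]$; (2) the algebra of formal power series $\mathbb K[[x_1,\ldots,x_n]]$; (3) the field of rational functions $\mathbb K(x_1,\ldots,x_n)$; (4) the fraction field $\mathbb K((x_1,\ldots,x_n))$ of the algebra $\mathbb K[[x_1,\ldots,x_n]]$. Let $\mathfrak D(A)$ be the Lie algebra of all $\mathbb K$-derivations $D$ of $A$ of the form $D=f_1\frac{\partial}{\partial x_1}+\cdots+f_n\frac{\partial}{\partial x_n}$ with $f_i\in A$. If $L$ is a nilpotent subalgebra of $\mathfrak D(A)$, then $L$ is finite dimensional over its field of constants $F$ (i.e. $\dim_F FL<\infty$) and $s(L)\le n$. If $L$ is a solvable subalgebra of $\mathfrak D(A)$ and the ground field $\mathbb K$ is of characteristic zero, then $s(L)\le 2n$.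
   Context: Let $R$ be the quotient field of $A$; derivations of $A$ extend uniquely to $R$. Subalgebras are $\mathbb K$-subalgebras. For a subalgebra $L$ of $\mathfrak D(A)$ the field of constants is $F=F(L)=\{r\in R \mid D(r)=0 \text{ for all } D\in L\}$, a subfield of $R$, and $FL$ is the $F$-span of $L$ inside $\mathrm{Der}\,R$, the Lie algebra of all $\mathbb K$-derivations of $R$; $FL$ is a Lie algebra over $F$. ''$L$ is finite dimensional over its field of constants'' means that $FL$ is a finite dimensional $F$-vector space. $s(L)$ denotes the derived length of a solvable Lie algebra $L$. In cases (1) and (2), $\mathfrak D(A)$ coincides with the Lie algebra $\mathrm{Der}\,A$ of all $\mathbb K$-derivations of $A$. *)

(* Defs.v *)
From HB Require Import structures.
From mathcomp Require Import all_boot all_order all_algebra.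
From mathcomp Require Import boolp classical_sets functions.
From mathcomp Require Import ssrcomplements freeg mpoly.
From mathcomp Require Import ring zify.

Set Implicit Arguments.
Unset Strict Implicit.
Unset Printing Implicit Defensive.

Import GRing.Theory.

Local Open Scope classical_set_scope.
Local Open Scope ring_scope.

Notation tofrac := (@FracField.tofrac _).
Notation "x %:F" := (tofrac x) : ring_scope.

Section Span.
Variables (K : pzRingType) (V : lmodType K).

(* S is meant to be K itself or a subfield of K; S-linear combinations are
   taken inside the K-module V, which makes sense of the F-span of a set of
   derivations without turning F into a type. *)
Definition span_over (S : set K) (X : set V) : set V :=
  [set v | exists (m : nat) (c : 'I_m -> K) (x : 'I_m -> V),
     [/\ forall i, S (c i), forall i, X (x i) & v = \sum_(i < m) c i *: x i]].

Definition finite_dim_over (S : set K) (W : set V) : Prop :=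
  exists (m : nat) (e : 'I_m -> V), W = span_over S (range e).

End Span.

Section LieAlgebras.
Variables (K : pzRingType) (A : lmodType K).
Implicit Types L M : set (A -> A).

Definition bracket (D E : A -> A) : A -> A := fun a => D (E a) - E (D a).

Definition lie_subalgebra L : Prop :=
  [/\ L 0,
      forall (c : K) D E, L D -> L E -> L (c *: D + E)
    & forall D E, L D -> L E -> L (bracket D E)].

Definition bracket_span L M : set (A -> A) :=
  span_over setT [set bracket D E | D in L & E in M].

Definition lower_central_series L (k : nat) : set (A -> A) :=
  iter k (bracket_span L) L.

Definition derived_series L (k : nat) : set (A -> A) :=
  iter k (fun M => bracket_span M M) L.

Definition lie_nilpotent L : Prop :=
  exists k, lower_central_series L k = [set 0].

Definition lie_solvable L : Prop :=
  exists k, derived_series L k = [set 0].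

Definition is_derived_length L (s : nat) : Prop :=
  derived_series L s = [set 0]
  /\ forall k, (k < s)%N -> derived_series L k <> [set 0].

End LieAlgebras.

#[short(type="idomainAlgType")]
HB.structure Definition IdomainAlgebra (K : nzRingType) :=
  {A of GRing.IntegralDomain A & GRing.ComAlgebra K A}.

Definition derivation (K : pzRingType) (A : comAlgType K) (D : A -> A) : Prop :=
  linear D /\ forall f g, D (f * g) = D f * g + f * D g.

Section FractionAlgebra.
Variables (K : nzRingType) (A : idomainAlgType K).

Definition frac_scale (c : K) (r : {fraction A}) : {fraction A} :=
  (c%:A)%:F * r.

Fact frac_scaleA a b r : frac_scale a (frac_scale b r) = frac_scale (a * b) r.
Proof. by rewrite /frac_scale mulrA -tofracM -scalerAl mul1r scalerA. Qed.

Fact frac_scale1 : left_id 1 frac_scale.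
Proof. by move=> r; rewrite /frac_scale scale1r tofrac1 mul1r. Qed.

Fact frac_scaleDr : right_distributive frac_scale +%R.
Proof. by move=> c r s; rewrite /frac_scale mulrDr. Qed.

Fact frac_scaleDl r : {morph frac_scale^~ r : a b / a + b}.
Proof. by move=> a b; rewrite /frac_scale scalerDl tofracD mulrDl. Qed.

HB.instance Definition _ := GRing.Zmodule_isLmodule.Build K {fraction A}
  frac_scaleA frac_scale1 frac_scaleDr frac_scaleDl.

Fact frac_scaleAl (c : K) (r s : {fraction A}) : c *: (r * s) = c *: r * s.
Proof. exact: mulrA. Qed.

HB.instance Definition _ :=
  GRing.Lmodule_isLalgebra.Build K {fraction A} frac_scaleAl.
HB.instance Definition _ := GRing.Lalgebra_isComAlgebra.Build K {fraction A}.

End FractionAlgebra.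

HB.instance Definition _ (K : idomainType) (n : nat) :=
  GRing.IntegralDomain.on {mpoly K[n]}.

Section QuotientRule.
Variable F : fieldType.
Implicit Types a b k : F.

Fact quot_add k a b a' b' : b != 0 -> b' != 0 ->
  k * (a / b) + a' / b' = (k * a * b' + a' * b) / (b * b').
Proof. by move=> b0 b'0; field; apply/andP. Qed.

Fact quot_rule_add k a b a' b' da db da' db' : b != 0 -> b' != 0 ->
  ((k * da * b' + k * a * db' + (da' * b + a' * db)) * (b * b')
     - (k * a * b' + a' * b) * (db * b' + b * db')) / (b * b') ^+ 2
  = k * ((da * b - a * db) / b ^+ 2) + (da' * b' - a' * db') / b' ^+ 2.
Proof. by move=> b0 b'0; field; apply/andP. Qed.

Fact quot_rule_mul a b a' b' da db da' db' : b != 0 -> b' != 0 ->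
  ((da * a' + a * da') * (b * b') - a * a' * (db * b' + b * db'))
     / (b * b') ^+ 2
  = (da * b - a * db) / b ^+ 2 * (a' / b')
    + a / b * ((da' * b' - a' * db') / b' ^+ 2).
Proof. by move=> b0 b'0; field; apply/andP. Qed.

End QuotientRule.

Section FractionDerivation.
Variables (K : nzRingType) (A : idomainAlgType K).
Implicit Types D : A -> A.

(* The quotient rule, on the representative \n_(repr r) / \d_(repr r) of r;
   by frac_derP and frac_der_unique this is the unique extension of the
   derivation D to the quotient field. *)
Definition frac_der D (r : {fraction A}) : {fraction A} :=
  let x := repr r in
  (D \n_x * \d_x - \n_x * D \d_x)%:F / (\d_x ^+ 2)%:F.

Lemma frac_repr (r : {fraction A}) : r = (\n_(repr r))%:F / (\d_(repr r))%:F.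
Proof.
have dn0 : (\d_(repr r))%:F != 0 :> {fraction A}.
  by rewrite tofrac_eq0 denom_ratioP.
apply: (canRL (mulfK dn0)).
move: (reprK r); move: (repr r) => x <-.
rewrite /FracField.tofrac; unlock.
rewrite -[LHS]FracField.pi_mul; apply/eqmodP => /=.
rewrite FracField.equivfE /FracField.mulf /=.
rewrite !numden_Ratio ?oner_eq0 ?mulr1 ?mulf_neq0 ?denom_ratioP //.
by rewrite mulrC.
Qed.

Lemma derivation1 D : derivation D -> D 1 = 0.
Proof.
move=> [_ DM]; have := DM 1 1; rewrite !mulr1 mul1r => /esym/eqP.
by rewrite -subr_eq0 addrK => /eqP.
Qed.

Lemma frac_derE D a b : derivation D -> b != 0 ->
  frac_der D (a%:F / b%:F) = (D a * b - a * D b)%:F / (b ^+ 2)%:F.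
Proof.
move=> [_ DM] b0; rewrite /frac_der; have := frac_repr (a%:F / b%:F).
set n := \n_(_); set d := \d_(_).
have d0 : d != 0 by exact: denom_ratioP.
have bF : b%:F != 0 :> {fraction A} by rewrite tofrac_eq0.
have dF : d%:F != 0 :> {fraction A} by rewrite tofrac_eq0.
move=> /eqP; rewrite eqr_div // -!tofracM tofrac_eq => /eqP adnb.
apply/eqP; rewrite eqr_div ?tofrac_eq0 ?expf_neq0 // -!tofracM tofrac_eq.
have Dadnb : D a * d + a * D d = D n * b + n * D b by rewrite -!DM adnb.
apply/eqP.
have -> : (D n * d - n * D d) * b ^+ 2 =
  (D n * b) * d * b - n * b * D d * b by ring.
have -> : D n * b = D a * d + a * D d - n * D b by rewrite Dadnb; ring.
rewrite -adnb.
have -> : (D a * d + a * D d - n * D b) * d * b - a * d * D d * b =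
   D a * d ^+ 2 * b - (n * b) * D b * d by ring.
by rewrite -adnb; ring.
Qed.

Lemma frac_derP D : derivation D ->
  derivation (frac_der D) /\ forall a, frac_der D a%:F = (D a)%:F.
Proof.
move=> hD; have [Dlin DM] := hD.
have D1 := derivation1 hD.
have tofracE a : frac_der D a%:F = (D a)%:F.
  rewrite -[a%:F]divr1 -tofrac1 frac_derE ?oner_neq0 // D1.
  by rewrite mulr0 subr0 mulr1 expr1n tofrac1 divr1.
have DD u v : D (u + v) = D u + D v by have := Dlin 1 u v; rewrite !scale1r.
have D0 : D 0 = 0 by apply: (addrI (D 0)); rewrite -DD !addr0.
have DZ c u : D (c *: u) = c *: D u by have := Dlin c u 0; rewrite D0 !addr0.
have fracE a b : b != 0 ->
    frac_der D (a%:F / b%:F) = ((D a)%:F * b%:F - a%:F * (D b)%:F) / b%:F ^+ 2.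
  by move=> b0; rewrite frac_derE // tofracB !tofracM.
have fracP (r : {fraction A}) : exists a b, b != 0 /\ r = a%:F / b%:F.
  by exists (\n_(repr r)), (\d_(repr r)); rewrite -frac_repr denom_ratioP.
split=> //; split=> [c r s|r s].
- have [a [b [b0 ->]]] := fracP r; have [a' [b' [b'0 ->]]] := fracP s.
  have scaleE x : c *: x = (c%:A)%:F * x :> {fraction A} by [].
  have bF : b%:F != 0 :> {fraction A} by rewrite tofrac_eq0.
  have b'F : b'%:F != 0 :> {fraction A} by rewrite tofrac_eq0.
  rewrite !scaleE; set k : A := c%:A.
  have Dk : D k = 0 by rewrite /k DZ D1 scaler0.
  have -> : k%:F * (a%:F / b%:F) + a'%:F / b'%:F
      = (k * a * b' + a' * b)%:F / (b * b')%:F :> {fraction A}.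
    by rewrite quot_add // tofracD !tofracM.
  rewrite !fracE ?mulf_neq0 // DD !DM Dk mul0r add0r !(tofracM, tofracD).
  exact: quot_rule_add.
- have [a [b [b0 ->]]] := fracP r; have [a' [b' [b'0 ->]]] := fracP s.
  have bF : b%:F != 0 :> {fraction A} by rewrite tofrac_eq0.
  have b'F : b'%:F != 0 :> {fraction A} by rewrite tofrac_eq0.
  have -> : a%:F / b%:F * (a'%:F / b'%:F)
      = (a * a')%:F / (b * b')%:F :> {fraction A}.
    by rewrite mulf_div !tofracM.
  rewrite !fracE ?mulf_neq0 // !DM !(tofracM, tofracD).
  exact: quot_rule_mul.
Qed.

Lemma frac_der_unique D (E : {fraction A} -> {fraction A}) :
  derivation E -> (forall a, E a%:F = (D a)%:F) -> E = frac_der D.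
Proof.
move=> [_ EM] ED; apply/funext => r; rewrite /frac_der.
set a := \n_(_); set b := \d_(_).
have bF : b%:F != 0 :> {fraction A} by rewrite tofrac_eq0 denom_ratioP.
have rE : a%:F = r * b%:F by rewrite {1}[r]frac_repr divfK.
have := EM r b%:F; rewrite -rE !ED => /eqP; rewrite -subr_eq => /eqP Er.
rewrite -[LHS](mulfK bF) -Er tofracB !tofracM rE.
rewrite invfM mulrA; congr (_ / _).
by rewrite [r * _ * _]mulrAC -mulrBl mulfK.
Qed.

End FractionDerivation.

(* scoef f m is the coefficient of x^m in f : K[[x_1, ..., x_n]]. *)
Record mpseries (n : nat) (K : Type) := MPSeries { scoef : 'X_{1..n} -> K }.

HB.instance Definition _ n K := gen_eqMixin (mpseries n K).
HB.instance Definition _ n K := gen_choiceMixin (mpseries n K).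

Section PowerSeries.
Variables (n : nat) (K : fieldType).
Implicit Types (f g h : mpseries n K) (m : 'X_{1..n}).

Lemma mpseriesP f g : (forall m, scoef f m = scoef g m) -> f = g.
Proof. by case: f g => [f] [g] /= fg; congr MPSeries; apply/funext. Qed.

Definition mps0 : mpseries n K := MPSeries (fun=> 0).
Definition mps_opp f := MPSeries (fun m => - scoef f m).
Definition mps_add f g := MPSeries (fun m => scoef f m + scoef g m).
Definition mps_scale (c : K) f := MPSeries (fun m => c * scoef f m).
Definition mps1 : mpseries n K := MPSeries (fun m => (m == 0%MM)%:R).

(* The degree bound only serves to make the index set of the sum finite. *)
Definition mps_mul f g := MPSeries (fun m =>
  \sum_(k : 'X_{1..n < (mdeg m).+1, (mdeg m).+1} | m == (k.1 + k.2)%MM)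
     scoef f k.1 * scoef g k.2).

Fact mps_addA : associative mps_add.
Proof. by move=> f g h; apply: mpseriesP => m /=; rewrite addrA. Qed.

Fact mps_addC : commutative mps_add.
Proof. by move=> f g; apply: mpseriesP => m /=; rewrite addrC. Qed.

Fact mps_add0 : left_id mps0 mps_add.
Proof. by move=> f; apply: mpseriesP => m /=; rewrite add0r. Qed.

Fact mps_addN : left_inverse mps0 mps_opp mps_add.
Proof. by move=> f; apply: mpseriesP => m /=; rewrite addNr. Qed.

HB.instance Definition _ := GRing.isZmodule.Build (mpseries n K)
  mps_addA mps_addC mps_add0 mps_addN.

Definition mps_trunc (d : nat) f : {mpoly K[n]} :=
  \sum_(m : 'X_{1..n < d}) scoef f m *: 'X_[m].

Lemma mps_truncE d f m : (mdeg m < d)%N -> (mps_trunc d f)@_m = scoef f m.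
Proof. exact: (mcoeff_mpoly (scoef f)). Qed.

(* A product of power series may be computed on polynomial truncations. *)
Lemma mps_mulE f g (p q : {mpoly K[n]}) d m : (mdeg m < d)%N ->
  (forall m', (mdeg m' < d)%N -> p@_m' = scoef f m') ->
  (forall m', (mdeg m' < d)%N -> q@_m' = scoef g m') ->
  scoef (mps_mul f g) m = (p * q)@_m.
Proof.
move=> md pf qg; rewrite mcoeffM /=; apply: eq_bigr => -[k1 k2] _ /=.
by rewrite pf ?qg //; apply: leq_trans md; rewrite ltnS -ltnS bmdeg.
Qed.

Lemma mps_mul_truncE f g d m : (mdeg m < d)%N ->
  (mps_trunc d f * mps_trunc d g)@_m = scoef (mps_mul f g) m.
Proof.
by move=> md; apply/esym/(mps_mulE md) => m' /mps_truncE.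
Qed.

Fact mps_mulA : associative mps_mul.
Proof.
move=> f g h; apply: mpseriesP => m; set d := (mdeg m).+1.
have tE f' : forall m', (mdeg m' < d)%N -> (mps_trunc d f')@_m' = scoef f' m'.
  exact: mps_truncE.
have mE f' g' m' : (mdeg m' < d)%N ->
    (mps_trunc d f' * mps_trunc d g')@_m' = scoef (mps_mul f' g') m'.
  exact: mps_mul_truncE.
rewrite (@mps_mulE _ _ _ _ d m (ltnSn _) (tE f) (mE g h)).
by rewrite (@mps_mulE _ _ _ _ d m (ltnSn _) (mE f g) (tE h)) mulrA.
Qed.

Fact mps_mulC : commutative mps_mul.
Proof.
move=> f g; apply: mpseriesP => m.
by rewrite -!(@mps_mul_truncE _ _ (mdeg m).+1) // mulrC.
Qed.

Fact mps_mul1 : left_id mps1 mps_mul.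
Proof.
move=> f; apply: mpseriesP => m.
rewrite (@mps_mulE _ _ 1 (mps_trunc (mdeg m).+1 f) (mdeg m).+1) //.
- by rewrite mul1r mps_truncE.
- by move=> m' _; rewrite mcoeff1.
- exact: mps_truncE.
Qed.

Fact mps_mulDl : left_distributive mps_mul +%R.
Proof.
move=> f g h; apply: mpseriesP => m /=; rewrite -big_split /=.
by apply: eq_bigr => k _; rewrite mulrDl.
Qed.

Fact mps1_neq0 : mps1 != 0.
Proof.
apply/eqP => /(congr1 (fun f => scoef f 0%MM)) /= /eqP.
by rewrite eqxx oner_eq0.
Qed.

HB.instance Definition _ := GRing.Zmodule_isComNzRing.Build (mpseries n K)
  mps_mulA mps_mulC mps_mul1 mps_mulDl mps1_neq0.

Fact mps_scaleA a b f : mps_scale a (mps_scale b f) = mps_scale (a * b) f.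
Proof. by apply: mpseriesP => m /=; rewrite mulrA. Qed.

Fact mps_scale1 : left_id 1 mps_scale.
Proof. by move=> f; apply: mpseriesP => m /=; rewrite mul1r. Qed.

Fact mps_scaleDr : right_distributive mps_scale +%R.
Proof. by move=> c f g; apply: mpseriesP => m /=; rewrite mulrDr. Qed.

Fact mps_scaleDl f : {morph mps_scale^~ f : a b / a + b}.
Proof. by move=> a b; apply: mpseriesP => m /=; rewrite mulrDl. Qed.

HB.instance Definition _ := GRing.Zmodule_isLmodule.Build K (mpseries n K)
  mps_scaleA mps_scale1 mps_scaleDr mps_scaleDl.

Fact mps_scaleAl (c : K) f g : c *: (f * g) = c *: f * g.
Proof.
apply: mpseriesP => m /=; rewrite mulr_sumr.
by apply: eq_bigr => k _; rewrite mulrA.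
Qed.

HB.instance Definition _ :=
  GRing.Lmodule_isLalgebra.Build K (mpseries n K) mps_scaleAl.
HB.instance Definition _ := GRing.Lalgebra_isComAlgebra.Build K (mpseries n K).

Definition mps_unit : {pred mpseries n K} := [pred f | `[<exists g, g * f = 1>]].

Definition mps_inv f : mpseries n K :=
  if pselect (exists g, g * f = 1) is left e then projT1 (cid e) else f.

Fact mps_mulVx : {in mps_unit, left_inverse 1 mps_inv *%R}.
Proof.
move=> f /asboolP fU; rewrite /mps_inv; case: pselect => // e.
by case: (cid e).
Qed.

Fact mps_unitPl f g : g * f = 1 -> mps_unit f.
Proof. by move=> gf; apply/asboolP; exists g. Qed.

Fact mps_inv_out : {in [predC mps_unit], mps_inv =1 id}.
Proof.
by move=> f; rewrite !inE => /asboolP fU; rewrite /mps_inv; case: pselect.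
Qed.

HB.instance Definition _ := GRing.ComNzRing_hasMulInverse.Build (mpseries n K)
  mps_mulVx mps_unitPl mps_inv_out.

Lemma mps_order f : f != 0 ->
  exists2 m, scoef f m != 0
    & forall m', (mdeg m' < mdeg m)%N -> scoef f m' = 0.
Proof.
move=> f0.
have : exists d, `[<exists2 m, scoef f m != 0 & mdeg m = d>].
  case: (pselect (exists m, scoef f m != 0)) => [[m fm]|f_eq0].
    by exists (mdeg m); apply/asboolP; exists m.
  case/eqP: f0; apply: mpseriesP => m; apply/eqP; apply: contrapT => /negP fm.
  by apply: f_eq0; exists m.
case/ex_minnP => d /asboolP[m fm md] dmin; exists m => // m' m'm.
apply/eqP; apply: contrapT => /negP fm'.
suff : (d <= mdeg m')%N by rewrite -md leqNgt m'm.
by apply: dmin; apply/asboolP; exists m'.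
Qed.

Fact mps_mulf_eq0 f g : f * g = 0 -> (f == 0) || (g == 0).
Proof.
move=> fg0; apply: contrapT => /negP; rewrite negb_or => /andP[f0 g0].
have [a fa amin] := mps_order f0; have [b gb bmin] := mps_order g0.
pose p : {mpoly K[n]} :=
  \sum_(m : 'X_{1..n < (mdeg a).+1}) (scoef f m) *: 'X_[m].
pose q : {mpoly K[n]} :=
  \sum_(m : 'X_{1..n < (mdeg b).+1}) (scoef g m) *: 'X_[m].
have pE m : p@_m = if (mdeg m < (mdeg a).+1)%N then scoef f m else 0.
  case: ltnP => [|am]; first exact: mps_truncE.
  rewrite raddf_sum /= big1 // => k _; rewrite mcoeffZ mcoeffX.
  by case: eqP => [km|]; rewrite ?mulr0 // leqNgt -km bmdeg in am *.
have qE m : q@_m = if (mdeg m < (mdeg b).+1)%N then scoef g m else 0.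
  case: ltnP => [|am]; first exact: mps_truncE.
  rewrite raddf_sum /= big1 // => k _; rewrite mcoeffZ mcoeffX.
  by case: eqP => [km|]; rewrite ?mulr0 // leqNgt -km bmdeg in am *.
have p0 : p != 0.
  by apply/eqP => /(congr1 (mcoeff a)); rewrite pE ltnSn mcoeff0; apply/eqP.
have q0 : q != 0.
  by apply/eqP => /(congr1 (mcoeff b)); rewrite qE ltnSn mcoeff0; apply/eqP.
have: p * q != 0 by rewrite mulf_neq0.
case/eqP; apply/mpolyP => m; rewrite mcoeff0.
case: (ltnP (mdeg a + mdeg b) (mdeg m)) => mab.
  rewrite mcoeffM big1 // => k /eqP/(congr1 mdeg); rewrite mdegD => mk.
  rewrite pE qE.
  case: ltnP => ka; last by rewrite mul0r.
  case: ltnP => kb; last by rewrite mulr0.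
  by exfalso; lia.
have := congr1 (fun h => scoef h m) fg0; rewrite /= => <-.
rewrite mcoeffM; apply: eq_bigr => k /eqP/(congr1 mdeg).
rewrite mdegD => mk; rewrite pE qE.
have {mk}kab : (mdeg k.1 + mdeg k.2 <= mdeg a + mdeg b)%N by rewrite -mk.
case: (ltngtP (mdeg k.1) (mdeg a)) => ka.
- by rewrite amin // !mul0r if_same mul0r.
- rewrite ltnS leqNgt ka /= mul0r bmin ?mulr0 // -(ltn_add2l (mdeg a)).
  by apply: leq_trans kab; rewrite ltn_add2r.
- rewrite ltnS ka leqnn; case: ltnP => // kb.
  by move: kab; rewrite ka leq_add2l leqNgt kb.
Qed.

HB.instance Definition _ :=
  GRing.ComUnitRing_isIntegral.Build (mpseries n K) mps_mulf_eq0.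

Definition mps_deriv (i : 'I_n) f : mpseries n K :=
  MPSeries (fun m => scoef f (m + U_(i))%MM *+ (m i).+1).

Lemma mps_derivP i : derivation (mps_deriv i).
Proof.
split=> [c f g|f g]; apply: mpseriesP => m.
  by rewrite /= mulrnDl mulrnAr.
set d := (mdeg m).+2.
have tE h m' : (mdeg m' < (mdeg m).+1)%N ->
    ((mps_trunc d h)^`M(i))@_m' = scoef (mps_deriv i h) m'.
  by move=> m'd; rewrite mcoeff_mderiv mps_truncE // mdegD mdeg1 addn1.
have -> : scoef (mps_deriv i (f * g)) m
    = ((mps_trunc d f * mps_trunc d g)^`M(i))@_m.
  by rewrite mcoeff_mderiv mps_mul_truncE // mdegD mdeg1 addn1.
rewrite mderivM mcoeffD; congr (_ + _).
  apply/esym; apply: (@mps_mulE _ _ _ _ (mdeg m).+1) => // m' m'd.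
    exact: tE.
  by rewrite mps_truncE // ltnW.
apply/esym; apply: (@mps_mulE _ _ _ _ (mdeg m).+1) => // m' m'd.
  by rewrite mps_truncE // ltnW.
exact: tE.
Qed.

End PowerSeries.

Inductive algebra_kind : Set :=
  | Polynomials
  | PowerSeries
  | RationalFunctions
  | LaurentFractions.

Section Algebras.
Variables (K : fieldType) (n : nat).

Definition algebra (t : algebra_kind) : idomainAlgType K :=
  match t with
  | Polynomials => {mpoly K[n]}
  | PowerSeries => mpseries n K
  | RationalFunctions => {fraction {mpoly K[n]}}
  | LaurentFractions => {fraction (mpseries n K)}
  end.

Definition partial (t : algebra_kind) (i : 'I_n) : algebra t -> algebra t :=
  match t with
  | Polynomials => mderiv i
  | PowerSeries => @mps_deriv n K i
  | RationalFunctions => frac_der (mderiv i : {mpoly K[n]} -> {mpoly K[n]})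
  | LaurentFractions => frac_der (@mps_deriv n K i)
  end.

Lemma partial_derivation t i : derivation (@partial t i).
Proof.
have mderivP : derivation (mderiv i : {mpoly K[n]} -> {mpoly K[n]}).
  by split=> [c p q|p q]; [exact: linearP | exact: mderivM].
case: t => /=; [exact: mderivP|exact: mps_derivP| |].
  by have [] := frac_derP mderivP.
by have [] := frac_derP (@mps_derivP n K i).
Qed.

Definition coord_derivations (t : algebra_kind) :
    set (algebra t -> algebra t) :=
  [set D | derivation D /\
     exists f : 'I_n -> algebra t, D = fun a => \sum_(i < n) f i * partial i a].

End Algebras.

(* The quotient field is {fraction A} also when A is already a field, in
   which case tofrac is an isomorphism from A onto it. *)
Section Constants.
Variables (K : nzRingType) (A : idomainAlgType K).

Definition constants (L : set (A -> A)) : set {fraction A} :=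
  [set r | forall D, L D -> frac_der D r = 0].

(* {fraction A} -> {fraction A}^o is the space of all maps R -> R, with R
   acting by (r *: D) x = r * D x. *)
Definition constant_span (L : set (A -> A)) :
    set ({fraction A} -> {fraction A}^o) :=
  span_over (V := {fraction A} -> {fraction A}^o)
    (constants L) [set frac_der D | D in L].

End Constants.

(* Main.v *)
Require Import Defs.
From HB Require Import structures.
From mathcomp Require Import all_boot all_order all_algebra.
From mathcomp Require Import boolp classical_sets functions.
From mathcomp Require Import ssrcomplements freeg mpoly.
From mathcomp Require Import ring zify.

(** Let R be the field of fractions of A.  A derivation of A in the span of the
    partial derivatives extends to R and is determined by its values at the n
    coordinates, so L becomes a Lie ring M of derivations of R whose span over
    R has dimension at most n.  Spaces of derivations over R are row spaces of
    n-column matrices.  The proof climbs a flag of such spaces U, each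
    normalized by M and spanned by elements of M, from 0 to the span of M;
    flag_stepP adds one storey, with a basis D of elements of M modulo U.

    If M is nilpotent, D can be chosen central modulo U.  Then U and D
    annihilate the coordinates, with respect to D, of all elements of M in the
    larger space, so brackets of these elements fall into U
    (central_step_abelian), and at most n steps use up at most n terms of the
    derived series.  Moreover M acts on vector fields modulo U through their
    coordinates, so by nilpotence these are killed by long products of elements
    of M.  The functions with this property form a finite dimensional space
    over the constants F, because a function is determined up to a constant by
    its images under a finite R-basis of the span of M (nilfun_finite_dim).
    Summing over the flag, the F-span of M is finite dimensional.

    If M is solvable, D can be chosen in the last term of the derived series
    that is not contained in U, an ideal that is abelian modulo U.  With
    respect to D the elements of M in the larger space are affine vector
    fields.  Sending them to their linear parts is a homomorphism onto a
    solvable Lie ring of k by k matrices over R, where k is the size of D; its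
    kernel is abelian modulo U.  In characteristic zero such a ring has derived
    length at most k (solvable_matrix_derived_length, a form of Lie's theorem
    that avoids algebraic closures), so the step costs at most k + 1 <= 2k
    terms of the derived series, and the whole flag at most 2n. *)

Set Implicit Arguments.
Unset Strict Implicit.
Unset Printing Implicit Defensive.

Import GRing.Theory.

Local Open Scope classical_set_scope.
Local Open Scope ring_scope.

(** * Lie rings and their derived series *)

Section LieRings.
Variable V : zmodType.
Implicit Types (B G S T : set V) (br : V -> V -> V).

Definition subgroup G : Prop :=
  G 0 /\ forall u v, G u -> G v -> G (u - v).

Lemma subgroupN G u : subgroup G -> G u -> G (- u).
Proof. by move=> [G0 GB] Gu; rewrite -[- u]add0r; apply: GB. Qed.

Lemma subgroupD G u v : subgroup G -> G u -> G v -> G (u + v).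
Proof.
by move=> sG Gu Gv; rewrite -[v]opprK; apply: sG.2 => //; apply: subgroupN.
Qed.

Inductive zspan B : V -> Prop :=
  | zspan_gen b of B b : zspan B b
  | zspan0 : zspan B 0
  | zspanB u v of zspan B u & zspan B v : zspan B (u - v).

Lemma zspan_subgroup B : subgroup (zspan B).
Proof. by split=> [|u v]; [exact: zspan0 | exact: zspanB]. Qed.

Lemma zspan_min B G : subgroup G -> B `<=` G -> zspan B `<=` G.
Proof.
by move=> [G0 GB] BG u; elim=> [b /BG|//|v w _ Gv _ Gw] //; exact: GB.
Qed.

(** The Lie axioms are required on S only, because the bracket of maps of a
    ring into itself is biadditive on additive maps but not on all maps. *)
Record lie_ring br S : Prop := LieRing {
  lie_subgroup : subgroup S;
  lie_br : forall a b, S a -> S b -> S (br a b);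
  lie_brB : forall a b c, S a -> S b -> S c ->
    br a (b - c) = br a b - br a c;
  lie_brC : forall a b, S a -> S b -> br a b = - br b a;
  lie_jacobi : forall a b c, S a -> S b -> S c ->
    br a (br b c) = br (br a b) c + br b (br a c) }.

Lemma sub_lie_ring br S T : lie_ring br S -> T `<=` S -> subgroup T ->
  (forall a b, T a -> T b -> T (br a b)) -> lie_ring br T.
Proof.
move=> lS TS sT brT; split=> // *.
- by apply: (lie_brB lS); apply: TS.
- by apply: (lie_brC lS); apply: TS.
- by apply: (lie_jacobi lS); apply: TS.
Qed.

Definition brackets br S T : set V := [set br a b | a in S & b in T].

(** Additive spans replace linear spans here: the terms of the derived series
    of a Lie algebra are stable under scaling in either description, and this
    one makes sense for Lie rings of matrices over a bigger field. *)
Definition derived_ring br S (j : nat) : set V :=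
  iter j (fun T => zspan (brackets br T T)) S.

Lemma derived_ringD br S i j :
  derived_ring br S (i + j) = derived_ring br (derived_ring br S i) j.
Proof. by rewrite addnC /derived_ring iterD. Qed.

Section Series.
Variables (br : V -> V -> V) (S : set V).
Hypothesis lS : lie_ring br S.

Lemma lie_br0 a : S a -> br a 0 = 0.
Proof.
move=> Sa; have S0 := (lie_subgroup lS).1.
by rewrite -[X in br a X](subrr 0) (lie_brB lS) // subrr.
Qed.

Let derived_ring_ind (j : nat) :
  [/\ subgroup (derived_ring br S j), derived_ring br S j `<=` S
    & forall a b, S a -> derived_ring br S j b ->
        derived_ring br S j (br a b)].
Proof.
have sS := lie_subgroup lS.
elim: j => [|j [sT TS idT]].
  by split=> // a b Sa Sb; apply: (lie_br lS).
have T'S : derived_ring br S j.+1 `<=` S.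
  apply: zspan_min => // _ [a Ta [b Tb <-]].
  by apply: (lie_br lS); apply: TS.
split=> //; first exact: zspan_subgroup.
move=> a b Sa /=; elim=> [_ [c Tc [d Td <-]]||u v Tu ihu Tv ihv].
- rewrite (lie_jacobi lS) //; try exact: TS.
  apply: subgroupD; first exact: zspan_subgroup.
    by apply: zspan_gen; exists (br a c); [exact: idT | exists d].
  by apply: zspan_gen; exists c => //; exists (br a d) => //; exact: idT.
- by rewrite lie_br0 //; exact: zspan0.
- by rewrite (lie_brB lS) //; [exact: zspanB | exact: T'S | exact: T'S].
Qed.

Lemma derived_ring_subgroup j : subgroup (derived_ring br S j).
Proof. by have [] := derived_ring_ind j. Qed.

Lemma derived_ring_sub j : derived_ring br S j `<=` S.
Proof. by have [] := derived_ring_ind j. Qed.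

Lemma derived_ring_ideal j a b : S a -> derived_ring br S j b ->
  derived_ring br S j (br a b).
Proof. by have [_ _] := derived_ring_ind j; exact. Qed.

Lemma lie_derived_ring j : lie_ring br (derived_ring br S j).
Proof.
apply: (sub_lie_ring lS (derived_ring_sub (j := j))).
  exact: derived_ring_subgroup.
by move=> a b /derived_ring_sub; exact: derived_ring_ideal.
Qed.

End Series.

Lemma derived_ring_le br S i j : lie_ring br S -> (i <= j)%N ->
  derived_ring br S j `<=` derived_ring br S i.
Proof.
move=> lS /subnK <-; rewrite addnC derived_ringD.
exact: (derived_ring_sub (lie_derived_ring lS i)).
Qed.

Lemma derived_ring_eq0 br S i j : lie_ring br S -> (i <= j)%N ->
  derived_ring br S i = [set 0] -> derived_ring br S j = [set 0].
Proof.
move=> lS ij Si; apply/seteqP; split.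
  by rewrite -Si; exact: derived_ring_le.
by move=> _ ->; exact: (derived_ring_subgroup lS j).1.
Qed.

End LieRings.

(** An additive map respecting brackets carries derived series to derived
    series; this is how solvability passes to quotients and restrictions. *)
Lemma derived_ring_image (V V' : zmodType) (br : V -> V -> V)
    (br' : V' -> V' -> V') (S : set V) (f : V -> V') (j : nat) :
  lie_ring br S -> {morph f : u v / u - v} ->
  (forall a b, S a -> S b -> f (br a b) = br' (f a) (f b)) ->
  derived_ring br' (f @` S) j = f @` derived_ring br S j.
Proof.
move=> lS fB fbr; have f0 : f 0 = 0 by rewrite -{1}(subrr 0) fB subrr.
elim: j => //= j ->; have TS := @derived_ring_sub _ _ _ lS j.
apply/seteqP; split=> [v|_ [u Tu <-]].
  elim=> [_ [_ [a Ta <-] [_ [b Tb <-] <-]]||u w _ [u' Tu <-] _ [w' Tw <-]].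
  - exists (br a b); last by apply: fbr; apply: TS.
    by apply: zspan_gen; exists a => //; exists b.
  - by exists 0; [exact: zspan0 | exact: f0].
  - by exists (u' - w'); [exact: zspanB | rewrite fB].
elim: Tu => [_ [a Ta [b Tb <-]]||u' w _ ihu _ ihw].
- rewrite fbr; [|exact: TS..]; apply: zspan_gen.
  by exists (f a); [exists a | exists (f b) => //; exists b].
- by rewrite f0; exact: zspan0.
- by rewrite fB; exact: zspanB.
Qed.

Lemma image_lie_ring (V V' : zmodType) (br : V -> V -> V)
    (br' : V' -> V' -> V') (S : set V) (f : V -> V') :
  lie_ring br S -> {morph f : u v / u - v} ->
  (forall a b, S a -> S b -> f (br a b) = br' (f a) (f b)) ->
  lie_ring br' (f @` S).
Proof.
move=> lS fB fbr; have f0 : f 0 = 0 by rewrite -{1}(subrr 0) fB subrr.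
have fN u : f (- u) = - f u by rewrite -[- u]add0r fB f0 add0r.
have fD u v : f (u + v) = f u + f v by rewrite -{1}[v]opprK fB fN opprK.
have [S0 SB] := lie_subgroup lS; have Sbr := lie_br lS.
split.
- split; first by exists 0.
  by move=> _ _ [a Sa <-] [b Sb <-]; exists (a - b); rewrite ?fB //; exact: SB.
- move=> _ _ [a Sa <-] [b Sb <-]; exists (br a b); last exact: fbr.
  exact: Sbr.
- move=> _ _ _ [a Sa <-] [b Sb <-] [c Sc <-].
  by rewrite -fB -!fbr ?(lie_brB lS) // ?fB //; exact: SB.
- move=> _ _ [a Sa <-] [b Sb <-].
  by rewrite -!fbr // (lie_brC lS) // fN.
- move=> _ _ _ [a Sa <-] [b Sb <-] [c Sc <-].
  have [Sab Sac Sbc] : [/\ S (br a b), S (br a c) & S (br b c)].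
    by split; exact: Sbr.
  rewrite -(fbr b c) // -(fbr a b) // -(fbr a c) //.
  rewrite -(fbr a (br b c)) // -(fbr (br a b) c) // -(fbr b (br a c)) // -fD.
  by rewrite (lie_jacobi lS).
Qed.

(** * Solvable Lie rings of matrices *)

Section RelativeBasis.
Variables (R : fieldType) (n : nat).

Lemma separating_functional (U : 'M[R]_n) (v : 'rV[R]_n) :
  ~~ (v <= U)%MS -> exists p : 'cV[R]_n, U *m p = 0 /\ v *m p = 1%:M.
Proof.
rewrite submxE => /rV0Pn[j wj].
set w := v *m cokermx U in wj *.
exists (cokermx U *m ((w 0 j)^-1 *: delta_mx j 0)); split.
  by rewrite mulmxA mulmx_coker mul0mx.
rewrite mulmxA -/w -scalemxAr -colE; move: w wj => w wj.
by apply/matrixP => a b; rewrite !ord1 !mxE eqxx mulVf.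
Qed.

(** The ideals met below are known through their elements, so a basis modulo U
    has to consist of members of B rather than of combinations of them.  Right
    multiplication by P reads off coordinates in that basis. *)
Lemma relative_basis (B : set 'rV[R]_n) (U : 'M[R]_n) :
  exists (k : nat) (b : 'M[R]_(k, n)) (P : 'M[R]_(n, k)),
    [/\ forall i, B (row i b), U *m P = 0, b *m P = 1%:M
      & forall v, B v -> (v <= U + b)%MS].
Proof.
have [m] := ubnP (n - \rank U); elim: m U => // m IH U Um.
have [BU|] := pselect (forall v, B v -> (v <= U)%MS).
  exists 0, (\matrix_(i, j) 0), (\matrix_(i, j) 0); split.
  - by case.
  - by apply/matrixP => i [].
  - by apply/matrixP => [[]].
  - by move=> v /BU vU; apply: submx_trans vU (addsmxSl _ _).
move/existsNP => [v /not_implyP[Bv /negP vU]].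
have [p [Up vp]] := separating_functional vU.
have rk : (\rank U < \rank (U + v)%MS)%N.
  have : (U < U + v)%MS by rewrite ltmxE addsmxSl addsmx_sub submx_refl.
  by rewrite ltmxErank => /andP[].
have [|k [b [P [Bb UvP bP genB]]]] := IH (U + v)%MS.
  by have := rank_leq_col (U + v)%MS; lia.
have UP : U *m P = 0.
  have : (U *m P <= (U + v)%MS *m P)%MS by apply/submxMr/addsmxSl.
  by rewrite UvP; exact: submx0null.
have vP : v *m P = 0.
  have : (v *m P <= (U + v)%MS *m P)%MS by apply/submxMr/addsmxSr.
  by rewrite UvP; exact: submx0null.
exists (1 + k)%N, (col_mx v b), (row_mx (p - P *m (b *m p)) P); split.
- move=> i; case: (splitP i) => j ij.
    rewrite (_ : i = lshift k j); last exact/val_inj.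
    by rewrite rowKu row_id.
  rewrite (_ : i = rshift 1 j); last exact/val_inj.
  by rewrite rowKd.
- by rewrite mul_mx_row mulmxBr (mulmxA U) Up UP mul0mx subr0 row_mx0.
- rewrite mul_col_row !mulmxBr (mulmxA v) (mulmxA b) vP bP vp.
  rewrite mul0mx mul1mx subr0 subrr.
  by rewrite -scalar_mx_block.
- move=> w /genB wUb; apply: submx_trans wUb _; rewrite !addsmx_sub addsmxSl.
  have /andP[vs bs] : (v <= col_mx v b)%MS && (b <= col_mx v b)%MS.
    by rewrite -!addsmxE addsmxSl addsmxSr.
  by rewrite !(submx_trans _ (addsmxSr _ _)).
Qed.

Lemma relative_coord0 m p k (U : 'M[R]_(m, n)) (P : 'M[R]_(n, k))
    (v : 'M[R]_(p, n)) : U *m P = 0 -> (v <= U)%MS -> v *m P = 0.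
Proof. by move=> UP /submxP[c ->]; rewrite -mulmxA UP mulmx0. Qed.

Lemma relative_coordP m p k (U : 'M[R]_(m, n)) (b : 'M[R]_(k, n))
    (P : 'M[R]_(n, k)) (v : 'M[R]_(p, n)) :
  U *m P = 0 -> b *m P = 1%:M -> (v <= U + b)%MS ->
  (v - v *m P *m b <= U)%MS.
Proof.
move=> UP bP /sub_addsmxP[[c d] /= ->].
have -> : (c *m U + d *m b) *m P = d.
  by rewrite mulmxDl -!mulmxA UP bP mulmx0 mulmx1 add0r.
by rewrite addrK submxMl.
Qed.

End RelativeBasis.

Section MatrixLieRings.
Variable R : fieldType.

Definition mxbracket k (a b : 'M[R]_k) : 'M[R]_k := a *m b - b *m a.

Hypothesis R_char0 : [pchar R] =i pred0.

Lemma deriv_neq0 (p : {poly R}) : (1 < size p)%N -> p^`() != 0.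
Proof.
case sp: (size p) => [|[|m]] // _; apply/eqP => /polyP/(_ m)/eqP.
rewrite coef_deriv coef0 -mulr_natr mulf_eq0 ((pcharf0P R).1 R_char0) orbF.
by rewrite -[m.+1]/(m.+2.-1) -sp -lead_coefE lead_coef_eq0 -size_poly_eq0 sp.
Qed.

(** If p(x) = 0, then bracketing with s and multiplying by y, again and again,
    shows that p^(j)(x) y^(2j) = 0 for all j; in characteristic zero some
    derivative of p is a nonzero constant, so a power of y vanishes. *)
Lemma commutator_nilpotent k (s x : 'M[R]_k.+1) (y := mxbracket s x) :
  GRing.comm x y -> GRing.comm y (mxbracket s y) -> exists N, y ^+ N = 0.
Proof.
have sx : s * x = x * s + y by rewrite addrC subrK.
clearbody y; move=> xy; set z := mxbracket s y => yz.
have zE : z = s * y - y * s by [].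
clearbody z.
have sq (q : {poly R}) : s * horner_mx x q =
    horner_mx x q * s + horner_mx x q^`() * y.
  elim/poly_ind: q => [|q c IH].
    by rewrite deriv0 rmorph0 !(mulr0, mul0r) addr0.
  rewrite derivMXaddC !rmorphD !rmorphM /= !horner_mx_X horner_mx_C.
  rewrite mulrDr mulrA IH mulrDl -(mulrA _ s) sx -(mulrA _ y) -xy.
  rewrite (_ : s * c%:M = c%:M * s); last exact/scalar_mxC.
  rewrite mulrDr !mulrDl !mulrA -!addrA; congr (_ + _).
  by rewrite addrA addrC.
have sy_exp m : (s * y ^+ m - y ^+ m * s) * y = (y ^+ m * z) *+ m.
  elim: m => [|m IH]; first by rewrite !expr0 mulr1 mul1r subrr mul0r mulr0n.
  have -> : s * y ^+ m.+1 - y ^+ m.+1 * s =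
      (s * y ^+ m - y ^+ m * s) * y + y ^+ m * z.
    rewrite exprSr zE mulrBl mulrBr !mulrA.
    by rewrite addrA subrK.
  by rewrite IH -mulrSr mulrnAl -mulrA -yz mulrA -exprSr.
have descend (q : {poly R}) m : horner_mx x q * y ^+ m = 0 ->
    horner_mx x q^`() * y ^+ m.+2 = 0.
  move=> qy0; have : s * (horner_mx x q * y ^+ m) * y =
      horner_mx x q * ((s * y ^+ m - y ^+ m * s) * y)
      + horner_mx x q * y ^+ m * (s * y) + horner_mx x q^`() * y ^+ m.+2.
    rewrite [y ^+ m.+2]exprS exprSr (mulrA s) sq mulrBl mulrBr !mulrDl !mulrA.
    by rewrite subrK.
  by rewrite sy_exp mulrnAr (mulrA (horner_mx x q)) qy0 mulr0 !mul0r mul0rn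
    !add0r.
(* Start from the characteristic polynomial, then lower the degree. *)
have [p [m [p0 py0]]] : exists (p : {poly R}) m,
    p != 0 /\ horner_mx x p * y ^+ m = 0.
  exists (char_poly x), 0; split; first exact/monic_neq0/char_poly_monic.
  by rewrite Cayley_Hamilton mul0r.
have [l] := ubnP (size p); elim: l p m p0 py0 => // l IH p m p0 py0 pl.
have [/size1_polyC pC|p1] := leqP (size p) 1; last first.
  apply: (IH p^`() m.+2); [exact: deriv_neq0 | exact: descend |].
  exact: leq_trans (lt_size_deriv p0) pl.
move: p0 py0; rewrite pC polyC_eq0 horner_mx_C => p0 py0; exists m.
apply: (scalerI p0); rewrite scaler0 -[RHS]py0.
exact/esym/mul_scalar_mx.
Qed.

End MatrixLieRings.

Section SolvableMatrices.
Variable R : fieldType.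
Hypothesis R_char0 : [pchar R] =i pred0.

(** A nonzero subspace stable under Y and of minimal rank is killed by each y
    in Y, since its image under the nilpotent map y is a smaller subspace,
    stable because y commutes with Y. *)
Lemma commuting_nilpotents_kernel k (Y : set 'M[R]_k.+1) :
  (forall y, Y y -> exists N, y ^+ N = 0) ->
  (forall y z, Y y -> Y z -> y *m z = z *m y) ->
  exists2 v : 'rV[R]_k.+1, v != 0 & forall y, Y y -> v *m y = 0.
Proof.
move=> Ynil Ycomm.
pose stable (W : 'M[R]_k.+1) := W != 0 /\ forall y, Y y -> (W *m y <= W)%MS.
have : exists r, `[<exists2 W, stable W & \rank W = r>].
  exists k.+1; apply/asboolP; exists 1%:M; last exact: mxrank1.
  by split=> [|y _]; [exact: oner_neq0 | exact: submx1].
case/ex_minnP => r /asboolP[W [W0 Wst] Wr] rmin.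
have WY0 y : Y y -> W *m y = 0.
  move=> Yy; apply: contrapT => /eqP Wy0.
  have /asboolP/rmin : exists2 V, stable V & \rank V = \rank (W *m y).
    exists (W *m y) => //; split=> // z Yz.
    by rewrite -mulmxA (Ycomm _ _ Yy Yz) mulmxA submxMr ?Wst.
  rewrite -Wr => rk; have WWy : (W <= W *m y)%MS.
    by have := mxrank_leqif_sup (Wst y Yy); move=> le; rewrite -(geq_leqif le).
  have [N yN] := Ynil y Yy; case/eqP: W0.
  have : (W <= W *m (y ^+ N))%MS.
    elim: (N) => [|m]; first by rewrite expr0 mulmx1.
    by move=> /(submxMr y)/(submx_trans WWy); rewrite exprSr -mulmxE mulmxA.
  by rewrite yN mulmx0 submx0 => /eqP.
exists (nz_row W); first by rewrite nz_row_eq0.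
move=> y Yy; have : (nz_row W *m y <= W *m y)%MS by rewrite submxMr ?nz_row_sub.
by rewrite WY0 // => /submx0null.
Qed.

Lemma common_kernel k (Y : set 'M[R]_k) : exists m (W : 'M[R]_(m, k)),
  forall v : 'rV[R]_k, (v <= W)%MS <-> forall y, Y y -> v *m y = 0.
Proof.
pose B : set 'rV[R]_k := [set v | forall y, Y y -> v *m y = 0].
have [m [W [P [BW _ _ genW]]]] := relative_basis B 0.
exists m, W => v; split=> [/submxP[c ->] y Yy|/genW].
  rewrite -mulmxA (_ : W *m y = 0) ?mulmx0 //.
  by apply/row_matrixP => i; rewrite row_mul BW // row0.
by move/submx_trans; apply; rewrite addsmx_sub sub0mx submx_refl.
Qed.

Definition mx_irreducible k (S : set 'M[R]_k) : Prop :=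
  forall m (W : 'M[R]_(m, k)), (forall s, S s -> stablemx W s) ->
    W = 0 \/ row_full W.

(** Schur's lemma for an element x of the centre: its kernel is stable. *)
Lemma irreducible_central_unit k (S : set 'M[R]_k) (x : 'M[R]_k) :
  mx_irreducible S -> (forall s, S s -> s *m x = x *m s) ->
  x != 0 -> x \in unitmx.
Proof.
move=> irrS xZ x0; have [s Ss||] := irrS _ (kermx x).
- by apply/sub_kermxP; rewrite -mulmxA xZ // mulmxA mulmx_ker mul0mx.
- by move/eqP; rewrite kermx_eq0 row_free_unit.
move=> full; case/eqP: x0; have [c ck] := row_fullP full.
by rewrite -[x]mul1mx -ck -mulmxA mulmx_ker mulmx0.
Qed.

(** Otherwise the last nonzero term T of the derived series lies in the derived
    ring.  The brackets [s, x] with x in T are commuting nilpotents; their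
    common kernel is nonzero and stable, hence everything, so they vanish: T is
    central, and a nonzero x in T is invertible.  But x is a sum of
    commutators, whose products with the central matrix x^-1 have trace zero,
    while x^-1 x has trace k, which is nonzero in characteristic zero. *)
Lemma irreducible_solvable_abelian k (S : set 'M[R]_k) (N : nat) :
  lie_ring (@mxbracket R k) S -> mx_irreducible S ->
  derived_ring (@mxbracket R k) S N = [set 0] ->
  derived_ring (@mxbracket R k) S 1 = [set 0].
Proof.
case: k S => [|k] S lS irrS SN.
  apply/seteqP; split=> [u _|_ ->]; first by apply/matrixP => -[].
  exact: (derived_ring_subgroup lS 1).1.
have : exists m, `[<derived_ring (@mxbracket R _) S m = [set 0]>].
  by exists N; apply/asboolP.
case/ex_minnP => -[|[|m]] /asboolP Sm minm.
- exact: derived_ring_eq0 Sm.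
- exact: Sm.
exfalso; set U := derived_ring (@mxbracket R _) S m in Sm.
set T := derived_ring (@mxbracket R _) S m.+1.
have TS : T `<=` S by exact: derived_ring_sub.
have US : U `<=` S by exact: derived_ring_sub.
have Tid s x : S s -> T x -> T (mxbracket s x) by exact: derived_ring_ideal.
have Tcomm x y : T x -> T y -> x *m y = y *m x.
  move=> Tx Ty; apply/eqP; rewrite -subr_eq0; apply/eqP.
  have : derived_ring (@mxbracket R _) S m.+2 (mxbracket x y).
    by apply: zspan_gen; exists x => //; exists y.
  by rewrite Sm.
have TZ s x : S s -> T x -> s *m x = x *m s.
  move=> Ss Tx; apply/eqP; rewrite -subr_eq0; apply/eqP.
  pose Y := brackets (@mxbracket R _) S T.
  have YT : Y `<=` T by move=> _ [t St [z Tz <-]]; exact: Tid.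
  have [d [W WP]] := common_kernel Y.
  have [t St||full] := irrS _ W.
  - apply/row_subP => i; apply/WP => y Yy; rewrite row_mul.
    have ker_y := (WP (row i W)).1 (row_sub i W).
    have Yty : Y (mxbracket t y) by exists t => //; exists y => //; exact: YT.
    have := ker_y _ Yty; rewrite mulmxBr !mulmxA (ker_y _ Yy) mul0mx subr0.
    exact.
  - move=> W0; exfalso.
    have [|y z Yy Yz|v v0 vY] := @commuting_nilpotents_kernel _ Y.
    + move=> _ [t St [z Tz <-]]; have Ttz := Tid _ _ St Tz.
      apply: (commutator_nilpotent R_char0); first exact: Tcomm Tz Ttz.
      exact: Tcomm Ttz (Tid _ _ St Ttz).
    + by apply: Tcomm; exact: YT.
    by case/eqP: v0; move/WP: vY; rewrite W0 => /submx0null.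
  have kerY z : Y z -> z = 0.
    move=> Yz; apply/row_matrixP => i; rewrite row0 rowE.
    exact: (WP _).1 (submx_full _ full) z Yz.
  by apply: kerY; exists s => //; exists x.
have [x Tx x0] : exists2 x, T x & x != 0.
  apply: contrapT => nT; have : (m.+2 <= m.+1)%N; last by rewrite ltnn.
  apply: minm; apply/asboolP/seteqP; split=> [x Tx|_ ->].
    by apply: contrapT => /eqP x0; apply: nT; exists x.
  exact: (derived_ring_subgroup lS m.+1).1.
have xU : x \in unitmx.
  by apply: irreducible_central_unit irrS _ x0 => s Ss; exact: TZ.
have tr0 : \tr (invmx x *m x) = 0.
  have TU : T `<=` zspan (brackets (@mxbracket R _) U U) by [].
  elim: {2}x / (TU x Tx) => [_ [a Ua [b Ub <-]]||a b _ iha _ ihb].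
  - have bx : b *m invmx x = invmx x *m b.
      rewrite -[LHS](mulKmx xU) (mulmxA x) -(TZ _ _ (US _ Ub) Tx).
      by rewrite -!mulmxA mulmxV // mulmx1.
    rewrite mulmxBr mulmxA raddfB /= [invmx x *m (b *m a)]mulmxA.
    rewrite -bx -(mulmxA b).
    by rewrite [\tr (b *m _)]mxtrace_mulC subrr.
  - by rewrite mulmx0 raddf0.
  - by rewrite mulmxBr raddfB /= iha ihb subrr.
move: tr0; rewrite mulVmx // mxtrace1 => /eqP.
by rewrite ((pcharf0P R).1 R_char0).
Qed.

(** By induction on k.  An irreducible S is abelian.  Otherwise S acts on a
    proper nonzero stable subspace W and on the quotient by W, and by induction
    some term of index less than k acts trivially on both; the product of two
    matrices of this kind is zero, so the next term vanishes. *)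
Theorem solvable_matrix_derived_length k (S : set 'M[R]_k) (N : nat) :
  lie_ring (@mxbracket R k) S -> derived_ring (@mxbracket R k) S N = [set 0] ->
  derived_ring (@mxbracket R k) S k = [set 0].
Proof.
have [m] := ubnP k; elim: m k S => // m IH k S km lS SN.
have [irrS|] := pselect (mx_irreducible S).
  have S1 := irreducible_solvable_abelian lS irrS SN.
  case: k {irrS} S S1 {IH km SN} lS => [|k] S S1 lS; last first.
    exact: derived_ring_eq0 S1.
  apply/seteqP; split=> [u _|_ ->]; first by apply/matrixP => -[].
  exact: (derived_ring_subgroup lS 0).1.
move=> /existsNP[d /existsNP[W /not_implyP[Wst /not_orP[W0 Wfull]]]].
have rk : (\rank W < k)%N by rewrite ltn_neqAle rank_leq_col andbT; exact/negP.
pose V := row_base W; have Vst s : S s -> (V *m s <= V)%MS.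
  by move=> Ss; rewrite stablemx_row_base; exact: Wst.
have VS s : S s -> V *m s = conjmx V s *m V.
  by move=> Ss; rewrite /conjmx mulmxKpV // Vst.
pose U := <<W>>%MS; have Ust s : S s -> (U *m s <= U)%MS.
  by move=> Ss; rewrite (eqmxMr s (genmxE W)) genmxE; exact: Wst.
have [q [b [P [_ UP bP gen]]]] := relative_basis setT U.
have full p (v : 'M[R]_(p, k)) : (v <= U + b)%MS.
  by apply/row_subP => i; exact: gen.
have qk : (q < k)%N.
  have bq : \rank b = q by apply/eqP/row_freeP; exists P.
  have := rank_leq_col b; rewrite bq leq_eqVlt => /predU1P[qk|//].
  have [c bc] : exists c, c *m b = 1%:M.
    by apply/row_fullP; rewrite /row_full bq qk.
  case: W0; apply/eqP; rewrite -(eqmx_eq0 (genmxE W)) -/U; apply/eqP.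
  have PN : P = c by rewrite -[P]mul1mx -bc -mulmxA bP mulmx1.
  by rewrite -[U]mulmx1 -bc -PN mulmxA UP mul0mx.
pose f s := conjmx V s; pose g s := b *m s *m P.
have fM s t : S s -> S t -> f (s *m t) = f s *m f t.
  by move=> Ss St; apply: conjmxM; rewrite inE Vst.
have gM s t : S s -> S t -> g (s *m t) = g s *m g t.
  move=> Ss St; have /(submxMr t) := relative_coordP UP bP (full _ (b *m s)).
  move=> /submx_trans/(_ (Ust t St))/(relative_coord0 UP)/eqP.
  by rewrite !mulmxBl subr_eq0 /g !mulmxA => /eqP.
have trivial_part p (h : 'M[R]_k -> 'M[R]_p) : (p < k)%N ->
    {morph h : s t / s - t} ->
    (forall s t, S s -> S t -> h (s *m t) = h s *m h t) ->
    forall s, derived_ring (@mxbracket R k) S p s -> h s = 0.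
  move=> pk hB hM s Ss; have hbr a c : S a -> S c ->
      h (mxbracket a c) = mxbracket (h a) (h c).
    by move=> Sa Sc; rewrite hB !hM.
  have hN : derived_ring (@mxbracket R p) (h @` S) N = [set 0].
    have h0 : h 0 = 0 by rewrite -(subrr (0 : 'M[R]_k)) hB subrr.
    by rewrite (derived_ring_image _ lS hB hbr) SN image_set1 h0.
  have : (h @` derived_ring (@mxbracket R k) S p) (h s) by exists s.
  rewrite -(derived_ring_image _ lS hB hbr).
  rewrite (IH _ _ _ (image_lie_ring lS hB hbr) hN) //.
  exact: leq_trans pk km.
set j := maxn (\rank W) q.
have kill s : derived_ring (@mxbracket R k) S j s -> (s <= U)%MS /\ U *m s = 0.
  move=> Sjs; have Ss := derived_ring_sub lS Sjs.
  have fs : f s = 0.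
    apply: (trivial_part _ f rk) => //; last first.
      exact: (derived_ring_le lS (leq_maxl _ _) Sjs).
    by move=> a c; rewrite /f /conjmx mulmxBr mulmxBl.
  have gs : g s = 0.
    apply: (trivial_part _ g qk) => //; last first.
      exact: (derived_ring_le lS (leq_maxr _ _) Sjs).
    by move=> a c; rewrite /g mulmxBr mulmxBl.
  have Us : U *m s = 0.
    have WU : (U <= V)%MS by rewrite /V eq_row_base genmxE.
    have Vs : V *m s = 0 by rewrite VS // -/(f s) fs mul0mx.
    by have := submxMr s WU; rewrite Vs => /submx0null.
  split=> //; have /(submxMr s) := full _ 1%:M.
  rewrite mul1mx => /submx_trans; apply.
  rewrite addsmxMr addsmx_sub Us sub0mx.
  have := relative_coordP UP bP (full _ (b *m s)).
  by rewrite -/(g s) gs mul0mx subr0.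
have jk : (j < k)%N by rewrite gtn_max rk qk.
apply: derived_ring_eq0 jk _ => //; apply/seteqP; split=> [|_ ->]; last first.
  exact: (derived_ring_subgroup lS j.+1).1.
apply: zspan_min; first by split=> [|_ _ -> ->] //; rewrite subrr.
move=> _ [s /kill[/submxP[x ->] Us] [t /kill[/submxP[y ->] Ut] <-]].
by rewrite /mxbracket -!mulmxA Us Ut !mulmx0 subrr.
Qed.

End SolvableMatrices.

(** * Dimension over a subfield given as a set *)

Section SubfieldDimension.
Variables (R : fieldType) (F : set R).

Record subfield : Prop := Subfield {
  subfield1 : F 1;
  subfieldB : forall a b, F a -> F b -> F (a - b);
  subfieldM : forall a b, F a -> F b -> F (a * b);
  subfieldV : forall a, F a -> F a^-1 }.

Hypothesis sfF : subfield.

Lemma subfield0 : F 0.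
Proof. by rewrite -(subrr 1); apply: subfieldB => //; exact: subfield1. Qed.

Lemma subfieldN a : F a -> F (- a).
Proof.
by move=> Fa; rewrite -sub0r; apply: subfieldB => //; exact: subfield0.
Qed.

Lemma subfieldD a b : F a -> F b -> F (a + b).
Proof.
by move=> Fa Fb; rewrite -[b]opprK; apply: subfieldB => //; exact: subfieldN.
Qed.

Section Subspaces.
Variable V : lmodType R.
Implicit Types (X W : set V).

Definition subspace W : Prop :=
  W 0 /\ forall c u v, F c -> W u -> W v -> W (c *: u + v).

Lemma subspace_sum W m (c : 'I_m -> R) (x : 'I_m -> V) : subspace W ->
  (forall i, F (c i)) -> (forall i, W (x i)) -> W (\sum_(i < m) c i *: x i).
Proof.
move=> [W0 WD] Fc Wx; elim/big_ind: _ => // [u v Wu Wv|i _].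
  by rewrite -[u]scale1r; apply: WD => //; exact: subfield1.
by rewrite -[_ *: _]addr0; exact: WD.
Qed.

Lemma span_over_min X W : subspace W -> X `<=` W -> span_over F X `<=` W.
Proof.
move=> sW XW v [m [c [x [Fc Xx ->]]]].
by apply: subspace_sum => // i; exact: XW.
Qed.

Lemma span_over_gen X : X `<=` span_over F X.
Proof.
move=> v Xv; exists 1, (fun=> 1), (fun=> v).
by split=> // [_|]; [exact: subfield1 | rewrite big_ord1 scale1r].
Qed.

Lemma span_over_subspace X : subspace (span_over F X).
Proof.
split.
  by exists 0, (fun=> 0), (fun=> 0); split=> [[]|[]|] //; rewrite big_ord0.
move=> a u v Fa [m [c [x [Fc Xx ->]]]] [p [d [y [Fd Xy ->]]]].
exists (m + p)%N,
  (fun i : 'I_(m + p) =>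
     match fintype.split i with inl j => a * c j | inr j => d j end),
  (fun i : 'I_(m + p) =>
     match fintype.split i with inl j => x j | inr j => y j end).
split=> [i|i|]; try by case: fintype.split => j //; apply: subfieldM.
rewrite big_split_ord /= scaler_sumr; congr (_ + _); apply: eq_bigr => i _.
  by rewrite (unsplitK (inl i)) scalerA.
by rewrite (unsplitK (inr i)).
Qed.

Lemma span_over_rangeP m (e : 'I_m -> V) v : span_over F (range e) v <->
  exists2 c : 'I_m -> R, (forall i, F (c i)) & v = \sum_i c i *: e i.
Proof.
split=> [|[c Fc ->]]; last first.
  by apply: subspace_sum => // [|i]; [exact: span_over_subspace |
    apply: span_over_gen; exists i].
move: v; apply: span_over_min => [|_ [i _ <-]].
  split.
    exists (fun=> 0) => [_|]; first exact: subfield0.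
    by rewrite big1 // => i _; rewrite scale0r.
  move=> a _ _ Fa [c Fc ->] [d Fd ->]; exists (fun i => a * c i + d i).
    by move=> i; apply: subfieldD => //; exact: subfieldM.
  rewrite scaler_sumr -big_split; apply: eq_bigr => i _.
  by rewrite scalerDl scalerA.
exists (fun j => (j == i)%:R).
  by move=> j; case: eqP => _; [exact: subfield1 | exact: subfield0].
rewrite (bigD1 i) //= eqxx scale1r big1 ?addr0 // => j /negPf ->.
by rewrite scale0r.
Qed.

Lemma finite_dim0 : finite_dim_over F [set (0 : V)].
Proof.
exists 0, (fun=> 0); apply/seteqP; split=> [_ ->|].
  exact: (span_over_subspace _).1.
by move=> v /span_over_rangeP[c _ ->]; rewrite big_ord0.
Qed.

Lemma finite_dim_extend W W' (w : V) : subspace W -> W w -> W' `<=` W ->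
  finite_dim_over F W' ->
  (forall v, W v -> exists2 c, F c & W' (v - c *: w)) -> finite_dim_over F W.
Proof.
move=> sW Ww W'W [m [e W'e]] ext.
exists m.+1, (fun i => oapp e w (unlift ord0 i)); apply/seteqP; split.
  move=> v /ext[a Fa]; rewrite W'e => /span_over_rangeP[c Fc vE].
  apply/span_over_rangeP; exists (fun i => oapp c a (unlift ord0 i)).
    by move=> i; case: unliftP => [j|] _ //=.
  rewrite big_ord_recl unlift_none /= -[v in LHS](subrK (a *: w)) vE addrC.
  by congr (_ + _); apply: eq_bigr => i _; rewrite liftK.
apply: span_over_min => // _ [i _ <-]; case: unliftP => [j|] _ //=.
by apply: W'W; rewrite W'e; apply: span_over_gen; exists j.
Qed.

End Subspaces.

Lemma linear_on0 (V U : lmodType R) (W : set V) (f : V -> U) : W 0 ->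
  (forall c u v, F c -> W u -> W v -> f (c *: u + v) = c *: f u + f v) ->
  f 0 = 0.
Proof.
move=> W0 flin; have := flin 1 0 0 (subfield1 sfF) W0 W0.
by rewrite scaler0 addr0 scale1r => /esym/eqP; rewrite -subr_eq0 addrK => /eqP.
Qed.

(** The rank-nullity bound, by induction on the number of vectors needed to
    span the image: the part of W sent to the span of all but the first of
    them has codimension at most one. *)
Lemma finite_dim_ker_im (V U : lmodType R) (W : set V) (f : V -> U)
    (m : nat) (e : 'I_m -> U) :
  subspace W ->
  (forall c u v, F c -> W u -> W v -> f (c *: u + v) = c *: f u + f v) ->
  (forall v, W v -> span_over F (range e) (f v)) ->
  finite_dim_over F [set v | W v /\ f v = 0] -> finite_dim_over F W.
Proof.
elim: m e W => [|m IH] e W sW flin fe fdker.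
  rewrite (_ : W = [set v | W v /\ f v = 0]) //.
  apply/seteqP; split=> [v Wv|v []//].
  by split=> //; have /span_over_rangeP[c _ ->] := fe _ Wv; rewrite big_ord0.
pose e' i := e (fintype.lift ord0 i).
pose W' := [set v | W v /\ span_over F (range e') (f v)].
have W'W : W' `<=` W by move=> v [].
have sW' : subspace W'.
  have [W0 WD] := sW; have [S0 SD] := span_over_subspace (range e').
  have f0 := linear_on0 W0 flin.
  split; first by split=> //; rewrite f0.
  move=> c u v Fc [Wu Su] [Wv Sv]; split; first exact: WD.
  by rewrite flin //; exact: SD.
have fdW' : finite_dim_over F W'.
  apply: (IH e') => // [c u v Fc /W'W Wu /W'W Wv|v []//|]; first exact: flin.
  rewrite (_ : [set v | _] = [set v | W v /\ f v = 0]) //.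
  apply/seteqP; split=> [v [/W'W]//|v [Wv fv]]; split=> //; split=> //.
  by rewrite fv; exact: (span_over_subspace _).1.
have [WW'|] := pselect (W `<=` W').
  by rewrite (_ : W = W') //; apply/seteqP.
move=> /existsNP[w /not_implyP[Ww nW'w]].
have lead v : W v ->
    exists2 a, F a & span_over F (range e') (f v - a *: e ord0).
  move=> /fe/span_over_rangeP[c Fc ->]; exists (c ord0) => //.
  rewrite big_ord_recl addrC addKr; apply/span_over_rangeP.
  by exists (fun i => c (fintype.lift ord0 i)).
have [a Fa Sa] := lead _ Ww.
have a0 : a != 0.
  apply/eqP => a0; apply: nW'w; split=> //.
  by move: Sa; rewrite a0 scale0r subr0.
apply: (finite_dim_extend sW Ww W'W fdW') => v Wv; have [b Fb Sb] := lead _ Wv.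
have Fba : F (b / a) by apply: subfieldM => //; exact: subfieldV.
exists (b / a) => //; have Nba := subfieldN Fba.
have -> : v - (b / a) *: w = (- (b / a)) *: w + v by rewrite scaleNr addrC.
split; first exact: sW.2.
rewrite flin //; have := (span_over_subspace (range e')).2 _ _ _ Nba Sa Sb.
rewrite scalerBr !scaleNr scalerA opprK divfK // addrACA.
by rewrite -addrA addrN addr0.
Qed.

(** By decreasing induction on i, the common kernel of the first i maps is
    finite dimensional. *)
Lemma finite_dim_kers (V U : lmodType R) (W : set V) (E : set U)
    (k : nat) (f : nat -> V -> U) :
  subspace W -> finite_dim_over F E ->
  (forall i c u v, (i < k)%N -> F c -> W u -> W v ->
     f i (c *: u + v) = c *: f i u + f i v) ->
  (forall i v, (i < k)%N -> W v -> E (f i v)) ->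
  finite_dim_over F [set v | W v /\ forall i, (i < k)%N -> f i v = 0] ->
  finite_dim_over F W.
Proof.
move=> sW [m [e ->]]; elim: k => [|k IH] flin fE fdker.
  by rewrite (_ : W = [set v | W v /\ forall i, (i < 0)%N -> f i v = 0]) //;
    apply/seteqP; split=> [v|v []].
have f0 i : (i < k.+1)%N -> f i 0 = 0.
  by move=> ik; apply: (linear_on0 sW.1) => c u v; exact: flin.
apply: IH => [i c u v /ltnW ik|i v /ltnW ik|]; [exact: flin | exact: fE |].
apply: (finite_dim_ker_im (f := f k) (e := e)).
- split=> [|c u v Fc [Wu fu] [Wv fv]].
    by split=> [|i /ltnW ik]; [exact: sW.1 | exact: f0].
  split=> [|i ik]; first exact: sW.2.
  by rewrite flin ?fu ?fv ?scaler0 ?addr0 //; exact: ltnW.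
- by move=> c u v Fc [Wu _] [Wv _]; exact: flin.
- by move=> v [Wv _]; exact: fE.
rewrite (_ : [set v | _] =
  [set v | W v /\ forall i, (i < k.+1)%N -> f i v = 0]) //.
apply/seteqP; split=> [v [[Wv fv] fkv]|v [Wv fv]].
  by split=> // i; rewrite ltnS leq_eqVlt => /predU1P[->//|/fv].
by do 2?split=> //; [move=> i /ltnW/fv | exact: fv].
Qed.

End SubfieldDimension.

(** * Lie rings of derivations in coordinates *)

Section Derivations.
Variable R : comNzRingType.
Implicit Types X Y Z : R -> R.

Definition ring_derivation X : Prop :=
  {morph X : a b / a - b} /\ forall a b, X (a * b) = X a * b + a * X b.

Definition dbracket X Y : R -> R := fun a => X (Y a) - Y (X a).

Lemma ring_derivation0 X : ring_derivation X -> X 0 = 0.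
Proof. by move=> [XB _]; have := XB 0 0; rewrite !subrr. Qed.

Lemma ring_derivationN X a : ring_derivation X -> X (- a) = - X a.
Proof.
by move=> dX; rewrite -sub0r dX.1 (ring_derivation0 dX) sub0r.
Qed.

Lemma ring_derivationD X a b : ring_derivation X -> X (a + b) = X a + X b.
Proof.
by move=> dX; rewrite -{1}[b]opprK dX.1 (ring_derivationN _ dX) opprK.
Qed.

Lemma ring_derivation_sum X (I : Type) (r : seq I) (P : pred I) (f : I -> R) :
  ring_derivation X ->
  X (\sum_(i <- r | P i) f i) = \sum_(i <- r | P i) X (f i).
Proof.
move=> dX; apply: (big_morph X) => [a b|]; first exact: ring_derivationD.
exact: ring_derivation0.
Qed.

Lemma derivation_lie_ring (M : set (R -> R)) :
  subgroup M -> M `<=` ring_derivation ->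
  (forall X Y, M X -> M Y -> M (dbracket X Y)) -> lie_ring dbracket M.
Proof.
move=> sM dM brM; split=> // [X Y Z|X Y _ _|X Y Z] /=.
- by move=> /dM[XB _] _ _; apply/funext => a; rewrite /dbracket !fctE XB; ring.
- by apply/funext => a; rewrite /dbracket !fctE opprB.
move=> /dM[XB _] /dM[YB _] /dM[ZB _].
by apply/funext => a; rewrite /dbracket !fctE XB YB ZB; ring.
Qed.

End Derivations.

Section Coordinates.
Variables (R : fieldType) (n : nat) (x : 'I_n -> R) (d : 'I_n -> R -> R).
Implicit Types (X Y : R -> R) (u v : 'rV[R]_n).

(** Derivations are handled through their values at the coordinates x, so
    that the spaces of derivations over R become row spaces of matrices. *)
Definition ev X : 'rV[R]_n := \row_i X (x i).

Definition der v (a : R) : R := \sum_i v 0 i * d i a.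

Definition frame k (D : 'I_k -> R -> R) : 'M[R]_(k, n) := \matrix_i ev (D i).

(** The bracket of X with the vector field of components v, in components. *)
Definition brv X v : 'rV[R]_n := map_mx X v - \row_l der v (X (x l)).

Lemma evB X Y : ev (X - Y) = ev X - ev Y.
Proof. by apply/rowP => i; rewrite !mxE. Qed.

Lemma ev0 : ev 0 = 0.
Proof. by apply/rowP => i; rewrite !mxE. Qed.

Lemma ev_sub_subgroup m (U : 'M[R]_(m, n)) : subgroup [set X | (ev X <= U)%MS].
Proof.
split=> [|X Y XU YU] /=; first by rewrite ev0 sub0mx.
by rewrite evB addmx_sub // eqmx_opp.
Qed.

Lemma derD u v a : der (u + v) a = der u a + der v a.
Proof. by rewrite -big_split; apply: eq_bigr => i _; rewrite mxE mulrDl. Qed.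

Lemma der_mul k (s : 'rV_k) (E : 'M_(k, n)) a :
  der (s *m E) a = \sum_i s 0 i * der (row i E) a.
Proof.
under eq_bigr do rewrite mulr_sumr.
rewrite exchange_big; apply: eq_bigr => j _; rewrite mxE mulr_suml.
by apply: eq_bigr => i _; rewrite mxE mulrA.
Qed.

Lemma brv_ev X Y : (forall a, Y a = der (ev Y) a) ->
  brv X (ev Y) = ev (dbracket X Y).
Proof. by move=> YE; apply/rowP => l; rewrite !mxE -YE. Qed.

Lemma brvD X u v : ring_derivation X -> brv X (u + v) = brv X u + brv X v.
Proof.
move=> dX; apply/rowP => l; rewrite !mxE derD (ring_derivationD _ _ dX).
by rewrite opprD addrACA.
Qed.

Lemma brv_mul X k (s : 'rV_k) (E : 'M_(k, n)) : ring_derivation X ->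
  brv X (s *m E) = map_mx X s *m E + s *m \matrix_i brv X (row i E).
Proof.
move=> dX; apply/rowP => l; rewrite !mxE der_mul (ring_derivation_sum _ _ _ dX).
rewrite -sumrB -big_split; apply: eq_bigr => i _.
by rewrite !mxE dX.2 /= mulrBr addrA.
Qed.

Section LieRing.
Variable M : set (R -> R).
Hypothesis lM : lie_ring (@dbracket R) M.
Hypothesis dM : M `<=` @ring_derivation R.
Hypothesis M_der : forall X, M X -> forall a, X a = der (ev X) a.

(** The row space of U stands for a space of derivations over R.  Stability
    lets M act on vector fields modulo U; being spanned by elements of M lets
    facts about the elements of M in U extend to all of U. *)
Definition stable (U : 'M[R]_n) : Prop :=
  forall X v, M X -> (v <= U)%MS -> (brv X v <= U)%MS.

Definition spanned (U : 'M[R]_n) : Prop :=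
  exists m (D : 'I_m -> R -> R), (forall i, M (D i)) /\ (U :=: frame D)%MS.

Lemma stable_frame X k (D : 'I_k -> R -> R) m (W : 'M_(m, n)) v :
  M X -> (forall i, M (D i)) -> (frame D <= W)%MS ->
  (forall i, (ev (dbracket X (D i)) <= W)%MS) ->
  (v <= frame D)%MS -> (brv X v <= W)%MS.
Proof.
move=> MX MD DW XDW /submxP[c ->]; rewrite brv_mul; last exact: dM.
apply: addmx_sub; first by apply: submx_trans (submxMl _ _) _.
apply: submx_trans (submxMl _ _) _; apply/row_subP => i.
by rewrite rowK rowK brv_ev //; exact: M_der.
Qed.

Lemma stable_bracket U X Y : stable U -> M X -> M Y -> (ev X <= U)%MS ->
  (ev (dbracket X Y) <= U)%MS /\ (ev (dbracket Y X) <= U)%MS.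
Proof.
move=> stU MX MY XU; have YX : (ev (dbracket Y X) <= U)%MS.
  by rewrite -brv_ev; [exact: stU | exact: M_der].
split=> //; rewrite (lie_brC lM) // -[- _]add0r evB.
by rewrite ev0 sub0r eqmx_opp.
Qed.

Lemma spanned_annihilates U (a : R) : spanned U ->
  (forall X, M X -> (ev X <= U)%MS -> X a = 0) ->
  forall v, (v <= U)%MS -> der v a = 0.
Proof.
move=> [m [D [MD UD]]] Ua v; rewrite UD => /submxP[c ->].
rewrite der_mul big1 // => i _; rewrite rowK -M_der // Ua ?mulr0 //.
by rewrite UD -[ev (D i)](rowK (fun i => ev (D i))) row_sub.
Qed.

Lemma stable0 : stable 0.
Proof.
move=> X v MX /submx0null ->; rewrite (_ : brv X 0 = 0) ?sub0mx //.
apply/rowP => l; rewrite !mxE (ring_derivation0 (dM MX)) sub0r.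
rewrite /der big1 ?oppr0 //.
by move=> i _; rewrite mxE mul0r.
Qed.

Lemma spanned0 : spanned 0.
Proof.
exists 0, (fun=> 0); split; first by case.
by apply/eqmxP; rewrite sub0mx; apply/andP; split=> //; apply/row_subP => -[].
Qed.

(** Adjoining to U the elements D of M, independent modulo U; multiplication by
    P gives the coordinates, modulo U, of the vector fields in the larger
    space. *)
Record flag_step (U : 'M[R]_n) k (D : 'I_k -> R -> R) (P : 'M[R]_(n, k)) :
    Prop := FlagStep {
  step_stable : stable U;
  step_spanned : spanned U;
  step_mem : forall i, M (D i);
  step_coord0 : U *m P = 0;
  step_coord1 : frame D *m P = 1%:M;
  step_stable' : stable (U + frame D)%MS;
  step_spanned' : spanned (U + frame D)%MS;
  step_rank : \rank (U + frame D)%MS = (\rank U + k)%N }.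

(** The hypothesis on brackets covers both uses: I is an ideal of M in the
    solvable case, and central modulo U in the nilpotent case. *)
Lemma flag_stepP U (I : set (R -> R)) : stable U -> spanned U -> I `<=` M ->
  (forall X Y, M X -> I Y -> I (dbracket X Y) \/ (ev (dbracket X Y) <= U)%MS) ->
  (exists2 Y, I Y & ~~ (ev Y <= U)%MS) ->
  exists k (D : 'I_k.+1 -> R -> R) P, [/\ flag_step U D P,
    forall i, I (D i) & forall Y, I Y -> (ev Y <= U + frame D)%MS].
Proof.
move=> stU spU IM idI [Y0 IY0 Y0U].
have [k [b [P [bI UP bP gen]]]] := relative_basis [set ev Y | Y in I] U.
have [D D_I DE] : exists2 D : 'I_k -> R -> R,
    forall i, I (D i) & frame D = b.
  have /choice[D ID] : forall i, exists Y, I Y /\ ev Y = row i b.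
    by move=> i; have [Y IY YE] := bI i; exists Y.
  exists D => [i|]; first by have [] := ID i.
  by apply/row_matrixP => i; rewrite rowK; have [] := ID i.
have genI Y : I Y -> (ev Y <= U + frame D)%MS.
  by move=> IY; rewrite DE; apply: gen; exists Y.
case: k b P D bI UP bP gen D_I DE genI => [|k] b P D bI UP bP gen D_I DE genI.
  case/negP: Y0U; apply: submx_trans (genI _ IY0) _.
  rewrite addsmx_sub submx_refl.
  by apply/row_subP => -[].
exists k, D, P; split=> //; split=> //.
- by move=> i; apply: IM.
- by rewrite DE.
- move=> X v MX /sub_addsmxP[[c e] /= ->]; rewrite brvD; last exact: dM.
  apply: addmx_sub.
    by rewrite (submx_trans _ (addsmxSl _ _)) ?stU ?submxMl.
  apply: (stable_frame (D := D)) => //; first by move=> i; apply: IM.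
  - exact: addsmxSr.
  - move=> i; have [/genI//|XDU] := idI X (D i) MX (D_I i).
    exact: submx_trans XDU (addsmxSl _ _).
  - exact: submxMl.
- have [m [E [ME UE]]] := spU.
  exists (m + k.+1)%N,
    (fun i => match fintype.split i with inl j => E j | inr j => D j end).
  split=> [i|]; first by case: fintype.split => j //; exact: IM.
  apply: eqmx_trans (adds_eqmx UE (eqmx_refl _)) _.
  rewrite (_ : frame (fun _ => _) = col_mx (frame E) (frame D)).
    exact: addsmxE.
  apply/row_matrixP => i; rewrite rowK; case: (splitP i) => j ij.
    rewrite (_ : i = lshift _ j) ?rowKu ?rowK ?(unsplitK (inl j)) //.
    exact/val_inj.
  rewrite (_ : i = rshift _ j) ?rowKd ?rowK ?(unsplitK (inr j)) //.
  exact/val_inj.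
- rewrite mxrank_disjoint_sum; last first.
    apply/eqP/rowV0P => v; rewrite sub_capmx => /andP[vU /submxP[c vE]].
    have := relative_coord0 UP vU.
    by rewrite vE -mulmxA DE bP mulmx1 => ->; rewrite mul0mx.
  congr addn; apply/eqP/row_freeP; exists P; by rewrite DE.
Qed.

(** * Coordinates in one step of the flag *)

Section Step.
Variables (U : 'M[R]_n) (k : nat) (D : 'I_k -> R -> R) (P : 'M[R]_(n, k)).
Hypothesis stepU : flag_step U D P.
Let U' := (U + frame D)%MS.

Definition coord X : 'rV[R]_k := ev X *m P.

Lemma coordB X Y : coord (X - Y) = coord X - coord Y.
Proof. by rewrite /coord evB mulmxBl. Qed.

Lemma coord_eq0 X : (ev X <= U)%MS -> coord X = 0.
Proof. exact: relative_coord0 (step_coord0 stepU). Qed.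

Lemma coord_remainder X : (ev X <= U')%MS ->
  (ev X - coord X *m frame D <= U)%MS.
Proof. exact: relative_coordP (step_coord0 stepU) (step_coord1 stepU). Qed.

Lemma sub_of_coord_eq0 X : (ev X <= U')%MS -> coord X = 0 -> (ev X <= U)%MS.
Proof. by move=> /coord_remainder + X0; rewrite X0 mul0mx subr0. Qed.

Lemma brv_coord X v : M X -> (v <= U')%MS ->
  brv X v *m P = map_mx X (v *m P)
    + v *m P *m \matrix_i coord (dbracket X (D i)).
Proof.
move=> MX vU'; set s := v *m P.
have vE : v = (v - s *m frame D) + s *m frame D by rewrite subrK.
rewrite {1}vE (brvD _ _ (dM MX)) mulmxDl.
have vU : (v - s *m frame D <= U)%MS.
  exact: relative_coordP (step_coord0 stepU) (step_coord1 stepU) vU'.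
rewrite (relative_coord0 (step_coord0 stepU) (step_stable stepU MX vU)) add0r.
rewrite (brv_mul _ _ (dM MX)) mulmxDl -(mulmxA (map_mx X s)) -(mulmxA s)
  (step_coord1 stepU) mulmx1.
congr (_ + _ *m _); apply/row_matrixP => i.
rewrite row_mul !rowK brv_ev //; exact/M_der/(step_mem stepU).
Qed.

(** If X centralizes D modulo U, then X acts on vector fields by acting on
    their coordinates. *)
Lemma brv_coord_central X v : M X ->
  (forall i, (ev (dbracket X (D i)) <= U)%MS) -> (v <= U')%MS ->
  brv X v *m P = map_mx X (v *m P).
Proof.
move=> MX XD vU'; rewrite brv_coord // (_ : \matrix_i _ = 0) ?mulmx0 ?addr0 //.
by apply/row_matrixP => i; rewrite rowK row0 coord_eq0.
Qed.

Lemma coord_central X Y : M X -> M Y ->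
  (forall i, (ev (dbracket X (D i)) <= U)%MS) -> (ev Y <= U')%MS ->
  coord (dbracket X Y) = map_mx X (coord Y).
Proof.
move=> MX MY XD YU'; rewrite /coord -brv_ev; last exact: M_der.
exact: brv_coord_central.
Qed.

(** The elements X of M in U form an ideal of M.  So [X, Y] has zero
    coordinates, and by coord_central these are the images under X of the
    coordinates of Y. *)
Lemma coord_annihilated Y i v : M Y -> (ev Y <= U')%MS -> (v <= U)%MS ->
  der v (coord Y 0 i) = 0.
Proof.
move=> MY YU'; apply: (spanned_annihilates (step_spanned stepU)) => X MX XU.
have XU_ Z : M Z -> (ev (dbracket X Z) <= U)%MS.
  by move=> MZ; have [] := stable_bracket (step_stable stepU) MX MZ XU.
have XYE : coord (dbracket X Y) = map_mx X (coord Y).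
  by apply: coord_central => // j; exact/XU_/(step_mem stepU).
by have := coord_eq0 (XU_ _ MY); rewrite XYE => /rowP/(_ i); rewrite !mxE.
Qed.

Definition coord_mx Y : 'M[R]_k := \matrix_(j, i) D j (coord Y 0 i).

Lemma map_coord X Y : M X -> M Y -> (ev X <= U')%MS -> (ev Y <= U')%MS ->
  map_mx X (coord Y) = coord X *m coord_mx Y.
Proof.
move=> MX MY XU' YU'; apply/rowP => i; rewrite [LHS]mxE [RHS]mxE M_der //.
rewrite -[ev X](subrK (coord X *m frame D)) derD.
rewrite (coord_annihilated _ MY YU' (coord_remainder XU')) add0r der_mul.
apply: eq_bigr => j _; rewrite rowK [coord_mx Y j i]mxE.
by rewrite (M_der (step_mem stepU j)).
Qed.

(** When D is central modulo U, its elements annihilate the coordinates of all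
    elements of M in the larger space, as those of U do in any case; hence
    brackets have zero coordinates. *)
Lemma central_step_abelian X Y :
  (forall Z i, M Z -> (ev (dbracket Z (D i)) <= U)%MS) ->
  M X -> M Y -> (ev X <= U')%MS -> (ev Y <= U')%MS ->
  (ev (dbracket X Y) <= U)%MS.
Proof.
move=> cD MX MY XU' YU'; have MD := step_mem stepU.
apply: sub_of_coord_eq0.
  by have [] := stable_bracket (step_stable' stepU) MX MY XU'.
rewrite coord_central // => [|i]; last exact: cD.
rewrite map_coord // (_ : coord_mx Y = 0) ?mulmx0 //.
apply/row_matrixP => j; rewrite row0.
have : coord (dbracket (D j) Y) = 0.
  apply: coord_eq0; rewrite (lie_brC lM) // -[- _]add0r evB.
  by rewrite ev0 sub0r eqmx_opp; exact: cD.
rewrite coord_central // => [<-|i]; last exact: cD.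
by apply/rowP => i; rewrite !mxE.
Qed.

(** If D spans, modulo U, an ideal I of M that is abelian modulo U, then the
    elements of M in U' are, modulo U, affine vector fields: their coefficients
    have degree at most one over the constants of D, and coord_mx is the linear
    part.  Linear parts form a Lie ring of k by k matrices, and elements with
    zero linear part commute modulo U. *)
Section AbelianStep.
Variable I : set (R -> R).
Hypothesis ID : forall i, I (D i).
Hypothesis IM : I `<=` M.
Hypothesis I_ideal : forall X Y, M X -> I Y -> I (dbracket Y X).
Hypothesis I_abelian : forall X Y, I X -> I Y -> (ev (dbracket X Y) <= U)%MS.
Hypothesis IU' : forall X, I X -> (ev X <= U')%MS.

Lemma coord_basis Y i : M Y -> (ev Y <= U')%MS ->
  coord (dbracket (D i) Y) = map_mx (D i) (coord Y).
Proof.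
move=> MY YU'; apply: coord_central => // [|j]; first exact: IM.
exact: I_abelian.
Qed.

Lemma coord_mx_constant l Y j i : M Y -> (ev Y <= U')%MS ->
  D l (coord_mx Y j i) = 0.
Proof.
move=> MY YU'; have IDY : I (dbracket (D j) Y) by exact: I_ideal.
have := coord_basis l (IM IDY) (IU' IDY).
rewrite coord_eq0; last exact: I_abelian.
by rewrite coord_basis // => /rowP/(_ i); rewrite !mxE.
Qed.

Lemma coord_bracket X Y : M X -> M Y -> (ev X <= U')%MS -> (ev Y <= U')%MS ->
  coord (dbracket X Y) = coord X *m coord_mx Y - coord Y *m coord_mx X.
Proof.
move=> MX MY XU' YU'; rewrite {1}/coord -brv_ev; last exact: M_der.
rewrite brv_coord // -/(coord Y) map_coord // -mulmxN; congr (_ + _ *m _).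
apply/row_matrixP => i; rewrite rowK (lie_brC lM) //; last exact/IM/ID.
rewrite -[- _]sub0r coordB coord_basis //.
have -> : coord 0 = 0 by apply: coord_eq0; rewrite ev0 sub0mx.
by apply/rowP => j; rewrite !mxE sub0r.
Qed.

Lemma coord_mx_bracket X Y :
  M X -> M Y -> (ev X <= U')%MS -> (ev Y <= U')%MS ->
  coord_mx (dbracket X Y) = mxbracket (coord_mx X) (coord_mx Y).
Proof.
move=> MX MY XU' YU'; apply/matrixP => l i.
have dD : ring_derivation (D l) by exact/dM/IM.
rewrite [LHS]mxE coord_bracket // /mxbracket !mxE dD.1.
rewrite !(ring_derivation_sum _ _ _ dD).
by congr (_ - _); apply: eq_bigr => j _;
  rewrite dD.2 coord_mx_constant // mulr0 addr0 [in RHS]mxE.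
Qed.

Lemma coord_mxB : {morph coord_mx : X Y / X - Y}.
Proof.
move=> X Y; apply/matrixP => j i; rewrite [LHS]mxE coordB.
have -> : (coord X - coord Y) 0 i = coord X 0 i - coord Y 0 i by rewrite !mxE.
by rewrite (dM (step_mem stepU j)).1 !mxE.
Qed.

Lemma coord_mx_abelian X Y : M X -> M Y ->
  (ev X <= U')%MS -> (ev Y <= U')%MS -> coord_mx X = 0 -> coord_mx Y = 0 ->
  (ev (dbracket X Y) <= U)%MS.
Proof.
move=> MX MY XU' YU' X0 Y0; apply: sub_of_coord_eq0.
  by have [] := stable_bracket (step_stable' stepU) MX MY XU'.
by rewrite coord_bracket // X0 Y0 !mulmx0 subrr.
Qed.

(** If the q-th term of the derived series lies in U', then k terms further
    the linear parts vanish, and the next term lies in U. *)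
Lemma abelian_step_derived q N : [pchar R] =i pred0 ->
  derived_ring (@dbracket R) M N = [set 0] ->
  (forall X, derived_ring (@dbracket R) M q X -> (ev X <= U')%MS) ->
  forall X, derived_ring (@dbracket R) M (q + k.+1) X -> (ev X <= U)%MS.
Proof.
move=> R0 MN qU'; set S := derived_ring _ M q in qU'.
have lS : lie_ring (@dbracket R) S by exact: lie_derived_ring.
have SM : S `<=` M by exact: derived_ring_sub.
have brS a b : S a -> S b ->
    coord_mx (dbracket a b) = mxbracket (coord_mx a) (coord_mx b).
  by move=> Sa Sb; apply: coord_mx_bracket;
    [exact: SM | exact: SM | exact: qU' ..].
have SN : derived_ring (@mxbracket R k) (coord_mx @` S) N = [set 0].
  rewrite (derived_ring_image _ lS coord_mxB brS) -derived_ringD.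
  rewrite (derived_ring_eq0 lM (leq_addl q N) MN) image_set1; congr [set _].
  by have := coord_mxB 0 0; rewrite !subrr.
have Sk := solvable_matrix_derived_length R0
  (image_lie_ring lS coord_mxB brS) SN.
have lin0 X : derived_ring (@dbracket R) S k X -> coord_mx X = 0.
  move=> SkX; have : (coord_mx @` derived_ring (@dbracket R) S k) (coord_mx X).
    by exists X.
  by rewrite -(derived_ring_image _ lS coord_mxB brS) Sk.
rewrite derived_ringD -/S; apply: zspan_min; first exact: ev_sub_subgroup.
move=> _ [Y SY [Z SZ <-]]; have SkS := derived_ring_sub lS (j := k).
by apply: coord_mx_abelian; [exact/SM/SkS | exact/SM/SkS | exact/qU'/SkS ..
  | exact: lin0 | exact: lin0].
Qed.

End AbelianStep.
End Step.

Lemma eq0_of_ev X : M X -> (ev X <= (0 : 'M[R]_n))%MS -> X = 0.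
Proof.
move=> MX /submx0null X0; apply/funext => a; rewrite M_der // X0.
by apply: big1 => i _; rewrite mxE mul0r.
Qed.

Lemma derived_ring_eq0_of_ev s :
  (forall X, derived_ring (@dbracket R) M s X -> (ev X <= (0 : 'M[R]_n))%MS) ->
  derived_ring (@dbracket R) M s = [set 0].
Proof.
move=> s0; apply/seteqP; split=> [X sX|_ ->].
  by apply: eq0_of_ev (s0 _ sX); exact: derived_ring_sub sX.
exact: (derived_ring_subgroup lM s).1.
Qed.

(** * Solvable Lie rings of derivations *)

Section Solvable.
Hypothesis R_char0 : [pchar R] =i pred0.
Variable N : nat.
Hypothesis MN : derived_ring (@dbracket R) M N = [set 0].

(** Modulo U the last nonzero term I of the derived series is an abelian
    ideal.  A step whose basis D lies in I and has k elements costs k terms of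
    the derived series to kill the linear parts and one more for what is then
    abelian modulo U, and k + 1 <= 2k. *)
Lemma solvable_flag U : stable U -> spanned U ->
  forall X, derived_ring (@dbracket R) M (2 * (n - \rank U)) X ->
    (ev X <= U)%MS.
Proof.
have [m] := ubnP (n - \rank U); elim: m U => // m IH U Um stU spU.
have : exists j,
    `[<forall X, derived_ring (@dbracket R) M j X -> (ev X <= U)%MS>].
  exists N; apply/asboolP; rewrite MN => _ ->.
  by rewrite ev0 sub0mx.
case/ex_minnP => -[|j] /asboolP jU jmin.
  by move=> X sX; apply: jU; exact: derived_ring_sub sX.
set I := derived_ring (@dbracket R) M j.
have IM : I `<=` M by exact: derived_ring_sub.
have sI : subgroup I by exact: derived_ring_subgroup.
have I_ideal X Y : M X -> I Y -> I (dbracket Y X).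
  move=> MX IY; rewrite (lie_brC lM) //; last exact: IM.
  by apply: subgroupN => //; exact: derived_ring_ideal.
have I_abelian X Y : I X -> I Y -> (ev (dbracket X Y) <= U)%MS.
  by move=> IX IY; apply: jU; apply: zspan_gen; exists X => //; exists Y.
have [Y IY YU] : exists2 Y, I Y & ~~ (ev Y <= U)%MS.
  apply: contrapT => nI; have := ltnn j; rewrite jmin //.
  by apply/asboolP => X IX; apply: contrapT => /negP XU; apply: nI; exists X.
have [||k [D [P [stepU ID IU']]]] := flag_stepP stU spU IM.
- by move=> X Z MX IZ; left; exact: derived_ring_ideal.
- by exists Y.
have rk := step_rank stepU; have rkn := rank_leq_col (U + frame D)%MS.
have qU' := IH (U + frame D)%MS _ (step_stable' stepU) (step_spanned' stepU).
move=> X sX.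
apply: (abelian_step_derived stepU ID IM I_ideal I_abelian IU' R_char0 MN).
  by apply: qU'; rewrite rk; lia.
by apply: derived_ring_le sX => //; rewrite rk; lia.
Qed.

Theorem solvable_derivations_derived_length :
  derived_ring (@dbracket R) M (2 * n) = [set 0].
Proof.
apply: derived_ring_eq0_of_ev => X sX; apply: (solvable_flag stable0 spanned0).
by rewrite mxrank0 subn0.
Qed.

End Solvable.

(** * Nilpotent Lie rings of derivations *)

Section Nilpotent.
(** G stands for the lower central series; it is axiomatized so that the image
    in R of the lower central series of L, taken over K, can be used. *)
Variables (G : nat -> set (R -> R)) (N : nat).
Hypothesis G0 : G 0 = M.
Hypothesis GM : forall i, G i `<=` M.
Hypothesis G_br : forall i X Y, M X -> G i Y -> G i.+1 (dbracket X Y).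
Hypothesis GN : G N = [set 0].

Lemma nilpotent_step U : stable U -> spanned U ->
  ~ (forall X, M X -> (ev X <= U)%MS) ->
  exists k (D : 'I_k.+1 -> R -> R) P, flag_step U D P
    /\ forall X i, M X -> (ev (dbracket X (D i)) <= U)%MS.
Proof.
move=> stU spU MU.
have : exists j, `[<forall X, G j X -> (ev X <= U)%MS>].
  exists N; apply/asboolP; rewrite GN => _ ->.
  by rewrite ev0 sub0mx.
case/ex_minnP => -[|j] /asboolP jU jmin; first by case: MU; rewrite -G0.
have central X Y : M X -> G j Y -> (ev (dbracket X Y) <= U)%MS.
  by move=> MX GY; apply: jU; exact: G_br.
have [Y GY YU] : exists2 Y, G j Y & ~~ (ev Y <= U)%MS.
  apply: contrapT => nG; have := ltnn j; rewrite jmin //.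
  by apply/asboolP => X GX; apply: contrapT => /negP XU; apply: nG; exists X.
have [||k [D [P [stepU GD _]]]] := flag_stepP stU spU (@GM j).
- by move=> X Z MX GZ; right; exact: central.
- by exists Y.
by exists k, D, P; split=> // X i MX; exact: central.
Qed.

(** Each step adds vector fields that are central modulo U and costs a single
    term of the derived series. *)
Lemma nilpotent_flag U : stable U -> spanned U ->
  forall X, derived_ring (@dbracket R) M (n - \rank U) X -> (ev X <= U)%MS.
Proof.
have [m] := ubnP (n - \rank U); elim: m U => // m IH U Um stU spU.
have [MU X sX|MU] := pselect (forall X, M X -> (ev X <= U)%MS).
  by apply: MU; exact: derived_ring_sub sX.
have [k [D [P [stepU cD]]]] := nilpotent_step stU spU MU.
have rk := step_rank stepU; have rkn := rank_leq_col (U + frame D)%MS.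
have qU' X : derived_ring (@dbracket R) M (n - \rank (U + frame D)%MS) X ->
    (ev X <= U + frame D)%MS.
  by apply: IH; [rewrite rk; lia | exact: step_stable' stepU
    | exact: step_spanned' stepU].
set q := (n - _)%N in qU'.
suff sU X : derived_ring (@dbracket R) M q.+1 X -> (ev X <= U)%MS.
  move=> X /derived_ring_le sX; apply: sU; apply: sX => //.
  by rewrite /q rk; lia.
move: X; apply: zspan_min; first exact: ev_sub_subgroup.
move=> _ [Y qY [Z qZ <-]]; have qM := derived_ring_sub lM (j := q).
by apply: (central_step_abelian stepU) => //; [exact: qM | exact: qM
  | exact: qU' | exact: qU'].
Qed.

Theorem nilpotent_derivations_derived_length :
  derived_ring (@dbracket R) M n = [set 0].
Proof.
apply: derived_ring_eq0_of_ev => X sX; apply: (nilpotent_flag stable0 spanned0).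
by rewrite mxrank0 subn0.
Qed.

(** * Finite dimension over the constants *)

Definition common_constants : set R := [set r | forall X, M X -> X r = 0].
Let F := common_constants.

Lemma common_constants_subfield : subfield F.
Proof.
split=> [X MX|a b Fa Fb X MX|a b Fa Fb X MX|a Fa X MX].
- have [_ XM] := dM MX; have := XM 1 1; rewrite !mulr1 mul1r => /esym/eqP.
  by rewrite -subr_eq0 addrK => /eqP.
- by rewrite (dM MX).1 (Fa X MX) (Fb X MX) subrr.
- by rewrite (dM MX).2 (Fa X MX) (Fb X MX) mul0r mulr0 addr0.
have [->|a0] := eqVneq a 0; first by rewrite invr0 (ring_derivation0 (dM MX)).
apply: (mulfI a0); rewrite mulr0; have [_ XM] := dM MX.
have := XM a a^-1; rewrite mulfV // (Fa X MX) mul0r add0r => <-.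
have := XM 1 1; rewrite !mulr1 mul1r => /esym/eqP.
by rewrite -subr_eq0 addrK => /eqP.
Qed.

(** These are the functions killed by all products of c elements of M.  As M
    acts nilpotently on vector fields, coordinates of its elements lie here. *)
Fixpoint nilfun (c : nat) : set R^o :=
  if c is c'.+1 then [set r | forall X, M X -> nilfun c' (X r)] else [set 0].

Lemma const_linear X (c a b : R) : M X -> F c -> X (c * a + b) = c * X a + X b.
Proof.
move=> MX Fc; rewrite (ring_derivationD _ _ (dM MX)) (dM MX).2.
by rewrite (Fc X MX) mul0r add0r.
Qed.

Lemma nilfun_subspace c : subspace F (nilfun c).
Proof.
elim: c => [|c [N0 ND]].
  by split=> // a _ _ _ -> ->; rewrite scaler0 addr0.
split=> [X MX|a u v Fa Nu Nv X MX]; first by rewrite (ring_derivation0 (dM MX)).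
rewrite (const_linear _ _ MX Fa); apply: ND => //; [exact: Nu | exact: Nv].
Qed.

(** All elements of M are combinations over R of finitely many of them. *)
Lemma finitely_many_tests : exists m (D : nat -> R -> R),
  (forall i, (i < m)%N -> M (D i)) /\
  (forall r, (forall i, (i < m)%N -> D i r = 0) -> F r).
Proof.
have [[Y MY Y0]|nM] := pselect (exists2 Y, M Y & ~~ (ev Y <= (0 : 'M[R]_n))%MS).
  have [||k [D [P [_ MD gen]]]] :=
    flag_stepP stable0 spanned0 (@subset_refl _ M).
  - by move=> X Z MX MZ; left; exact: (lie_br lM).
  - by exists Y.
  exists k.+1, (fun i => D (inord i)); split=> [i _|r Dr X MX]; first exact: MD.
  have := gen _ MX; rewrite adds0mx => /submxP[c XE].
  rewrite M_der // XE der_mul big1 // => i _.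
  by rewrite rowK -M_der // -(inord_val i) Dr // mulr0.
exists 0, (fun=> id); split=> // r _ X MX; rewrite (eq0_of_ev MX) //.
by apply: contrapT => /negP X0; apply: nM; exists X.
Qed.

(** A function in nilfun c.+1 is determined up to a constant by its images
    under finitely many elements of M, which lie in nilfun c. *)
Lemma nilfun_finite_dim c : finite_dim_over F (nilfun c).
Proof.
have sfF := common_constants_subfield.
elim: c => [|c IH]; first exact: finite_dim0.
have [m [D [MD Dtest]]] := finitely_many_tests.
apply: (finite_dim_kers sfF (V := R^o) (W := nilfun c.+1) (E := nilfun c)
  (k := m) (f := D)) => //.
- exact: nilfun_subspace.
- by move=> i a u v im Fa _ _; apply: const_linear => //; exact: MD.
- by move=> i v im Nv; apply: Nv; exact: MD.
pose W : set R^o := F.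
rewrite (_ : [set v | _] = W); last first.
  apply/seteqP; split=> [v [_ /Dtest]//|v Fv]; split=> [X MX|i /MD MDi].
    by rewrite Fv //; exact: (nilfun_subspace c).1.
  by rewrite Fv.
have sW : subspace F W.
  split=> [|a u v Fa Wu Wv]; first exact: subfield0 sfF.
  by apply: (subfieldD sfF) => //; exact: (subfieldM sfF).
apply: (finite_dim_extend sfF (W' := [set 0]) (w := (1 : R^o)) sW).
- exact: subfield1 sfF.
- by move=> _ ->; exact: sW.1.
- exact: finite_dim0.
by move=> v Wv; exists v => //=; rewrite /GRing.scale /= mulr1 subrr.
Qed.

Let V : lmodType R := (R -> R^o).

Definition span_const (S : set (R -> R)) : set V := span_over F (S : set V).

Lemma span_constS (S T : set (R -> R)) : S `<=` T ->
  span_const S `<=` span_const T.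
Proof.
move=> ST; have sfF := common_constants_subfield.
apply: (span_over_min sfF); first exact: (span_over_subspace sfF).
by move=> X SX; apply: (span_over_gen sfF); exact: ST.
Qed.

Lemma evZD c (X Y : V) : ev (c *: X + Y : V) = c *: ev X + ev Y.
Proof. by apply/rowP => i; rewrite !mxE. Qed.

Lemma span_const_der X : span_const M X -> forall a, X a = der (ev X) a.
Proof.
pose W : set V := [set X | forall a, X a = der (ev X) a].
suff : span_const M `<=` W by apply.
apply: (span_over_min common_constants_subfield); last exact: M_der.
split=> [a|c u v _ Wu Wv a].
  by rewrite /der big1 // => i _; rewrite mxE mul0r.
rewrite evZD -mul_scalar_mx derD der_mul big_ord1 mxE eqxx mulr1n.
rewrite (_ : row 0 (ev u) = ev u) -?Wu -?Wv //.
by apply/rowP => j; rewrite !mxE.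
Qed.

Lemma span_const_br i X Y : M X -> span_const (G i) Y ->
  span_const (G i.+1) (dbracket X Y).
Proof.
move=> MX; have sfF := common_constants_subfield.
have [S0 SD] := span_over_subspace sfF (G i.+1 : set V).
pose W : set V := [set Y | span_const (G i.+1) (dbracket X Y)].
suff : span_const (G i) `<=` W by apply.
apply: (span_over_min sfF) => [|Z GZ]; last first.
  by apply: (span_over_gen sfF); exact: G_br.
split=> [|c u v Fc Wu Wv]; rewrite /W /=.
  rewrite (_ : dbracket X 0 = 0) //; apply/funext => a.
  by rewrite /dbracket /= (ring_derivation0 (dM MX)) subrr.
rewrite (_ : dbracket X _ = c *: (dbracket X u : V) + dbracket X v).
  exact: SD.
apply/funext => a; rewrite /dbracket !fctE /= (const_linear _ _ MX Fc).
by rewrite /GRing.scale /=; ring.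
Qed.

(** Bracketing with M moves down the series G, which ends at zero, and acts on
    coordinates through their values because D is central modulo U. *)
Lemma coord_nilfun U k (D : 'I_k -> R -> R) (P : 'M[R]_(n, k)) :
  flag_step U D P -> (forall X i, M X -> (ev (dbracket X (D i)) <= U)%MS) ->
  forall c i X l, (i + c = N)%N -> span_const (G i) X ->
    (ev X <= U + frame D)%MS -> nilfun c (coord P X 0 l).
Proof.
move=> stepU cD; elim=> [|c IH] i X l.
  rewrite addn0 => -> ; rewrite /span_const GN => X0 _.
  have -> : X = 0.
    move: X X0; apply: (span_over_min common_constants_subfield
      (W := [set (0 : V)])) => //.
    by split=> // a _ _ _ -> ->; rewrite scaler0 addr0.
  by rewrite /= /coord ev0 mul0mx mxE.
rewrite addnS -addSn => icN GX XU' Y MY.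
have XE : forall a, X a = der (ev X) a.
  exact/span_const_der/(span_constS (@GM i)).
have := IH i.+1 (dbracket Y X) l icN (span_const_br MY GX).
rewrite /coord -brv_ev // (brv_coord_central stepU) // => [|j]; last exact: cD.
by rewrite mxE; apply; exact: (step_stable' stepU).
Qed.

(** Going up a step of the flag adds coordinates that take values in the finite
    dimensional space nilfun N. *)
Lemma finite_dim_flag U : stable U -> spanned U ->
  finite_dim_over F [set X : V | span_const M X /\ (ev X <= U)%MS] ->
  finite_dim_over F (span_const M).
Proof.
have sfF := common_constants_subfield.
have subU (W : 'M_n) :
    subspace F [set X : V | span_const M X /\ (ev X <= W)%MS].
  have [S0 SD] := span_over_subspace sfF (M : set V).
  split=> [|c u v Fc [Su uW] [Sv vW]]; first by rewrite /= ev0 sub0mx.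
  by split; [exact: SD | rewrite evZD addmx_sub ?scalemx_sub].
have [m] := ubnP (n - \rank U); elim: m U => // m IH U Um stU spU fdU.
have [MU|MU] := pselect (forall X, M X -> (ev X <= U)%MS).
  rewrite (_ : span_const M =
    [set X : V | span_const M X /\ (ev X <= U)%MS]) //.
  apply/seteqP; split=> [|X []//].
  apply: (span_over_min sfF) => // X MX; split; last exact: MU.
  exact: (span_over_gen sfF).
have [k [D [P [stepU cD]]]] := nilpotent_step stU spU MU.
have rk := step_rank stepU; have rkn := rank_leq_col (U + frame D)%MS.
apply: (IH (U + frame D)%MS); [rewrite rk; lia | exact: step_stable' stepU
    | exact: step_spanned' stepU |].
apply: (finite_dim_kers sfF (V := V) (U := R^o) (E := nilfun N) (k := k.+1)
  (f := fun i X => coord P X 0 (inord i)) (subU _)).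
- exact: nilfun_finite_dim.
- by move=> i c u v _ _ _ _; rewrite /coord evZD mulmxDl -scalemxAl !mxE.
- move=> i X _ [SX XU']; apply: (coord_nilfun stepU cD (i := 0)) => //.
  by rewrite G0.
rewrite (_ : [set v | _] = [set X : V | span_const M X /\ (ev X <= U)%MS]) //.
apply/seteqP; split=> X [].
  move=> [SX XU'] X0; split=> //; apply: (sub_of_coord_eq0 stepU) => //.
  by apply/rowP => i; rewrite [RHS]mxE -(X0 i (ltn_ord i)) inord_val.
move=> SX XU; split=> [|i _]; last by rewrite (coord_eq0 stepU XU) mxE.
by split=> //; rewrite (submx_trans XU) ?addsmxSl.
Qed.

Theorem nilpotent_derivations_finite_dim :
  finite_dim_over F (span_const M).
Proof.
apply: (finite_dim_flag stable0 spanned0).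
have sfF := common_constants_subfield.
rewrite (_ : [set X | _] = [set (0 : V)]); first exact: finite_dim0.
apply/seteqP; split=> [X [SX /submx0null X0]|_ ->]; last first.
  by split; [exact: (span_over_subspace sfF _).1 | rewrite ev0 sub0mx].
apply/funext => a; rewrite (span_const_der SX) X0 /der big1 // => i _.
by rewrite mxE mul0r.
Qed.

End Nilpotent.

End LieRing.
End Coordinates.

(** * From subalgebras of derivations to Lie rings of derivations *)

Section Subalgebras.
Variables (K : fieldType) (A : idomainAlgType K).
Variable L : set (A -> A).
Hypothesis L_sub : lie_subalgebra L.
Hypothesis L_der : forall D, L D -> derivation D.

Let setT_subfield : subfield (setT : set K).
Proof. by []. Qed.

Let L_scale c D : L D -> L (c *: D).
Proof. by have [L0 LD _] := L_sub => ?; rewrite -[_ *: _]addr0; exact: LD. Qed.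

Lemma derivation_ring (D : A -> A) : derivation D -> ring_derivation D.
Proof.
move=> [Dlin DM]; split=> // a b.
have := Dlin (-1) b a; rewrite !scaleN1r => e.
by rewrite addrC e addrC.
Qed.

Lemma subalgebra_lie_ring : lie_ring (@dbracket A) L.
Proof.
have [L0 LD Lbr] := L_sub; apply: derivation_lie_ring => //.
- split=> // u v Lu Lv; rewrite addrC -scaleN1r; exact: LD.
- by move=> D /L_der/derivation_ring.
Qed.

(** Linear spans agree with additive ones because c [D, E] = [c D, E] and every
    term of the series is stable under scaling. *)
Lemma derived_seriesE j : derived_series L j = derived_ring (@dbracket A) L j.
Proof.
suff : derived_series L j = derived_ring (@dbracket A) L j /\
    forall c D, derived_series L j D -> derived_series L j (c *: D) by case.
elim: j => [|j [IH scale]]; first by split=> // c D; exact: L_scale.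
have [S0 SD] := span_over_subspace setT_subfield
  [set bracket D E | D in derived_series L j & E in derived_series L j].
split=> [|c D SD_]; last by rewrite -[_ *: _]addr0; apply: SD.
have jL : derived_series L j `<=` L.
  by rewrite IH; apply: derived_ring_sub; exact: subalgebra_lie_ring.
rewrite /= -/(derived_ring (@dbracket A) L j) -IH.
apply/seteqP; split; last first.
  apply: zspan_min; last exact: span_over_gen.
  by split=> // u v Su Sv; rewrite addrC -scaleN1r; exact: SD.
move=> _ [m [c [X [_ brX ->]]]].
have sZ := zspan_subgroup (brackets (@dbracket A) (derived_series L j)
  (derived_series L j)).
elim/big_ind: _ => [|u v Zu Zv|i _]; first exact: sZ.1.
  exact: subgroupD.
have [D sD [E sE <-]] := brX i; apply: zspan_gen.
exists (c i *: D); first exact: scale.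
exists E => //; apply/funext => a; rewrite /dbracket /bracket !fctE.
have [Elin _] := L_der (jL _ sE).
have EZ := Elin (c i) (D a) 0; rewrite !addr0 in EZ.
have E0 : E 0 = 0 by apply: ring_derivation0; exact/derivation_ring/L_der/jL.
by rewrite EZ E0 addr0 scalerBr.
Qed.

Lemma lower_central_series_sub j : lower_central_series L j `<=` L.
Proof.
have [L0 LD Lbr] := L_sub; elim: j => [//|j IH].
apply: (span_over_min setT_subfield); first by split=> // c u v _; exact: LD.
by move=> _ [D LD_ [E /IH LE <-]]; exact: Lbr.
Qed.

Lemma exists_derived_length s : derived_series L s = [set 0] ->
  exists2 s', is_derived_length L s' & (s' <= s)%N.
Proof.
move=> Ls; have : exists j, `[<derived_series L j = [set 0]>].
  by exists s; apply/asboolP.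
case/ex_minnP => j /asboolP Lj jmin; exists j; last exact/jmin/asboolP.
by split=> // i ij /asboolP/jmin; rewrite leqNgt ij.
Qed.

(** * Extension to the field of fractions *)

Let R : fieldType := {fraction A}.

Local Notation fder := (@frac_der K A).

Lemma frac_derB : {morph fder : D E / D - E}.
Proof.
move=> D E; apply/funext => r; rewrite /frac_der !fctE -mulrBl -tofracB.
by congr (tofrac _ / _); ring.
Qed.

Lemma frac_der_tofrac D a : derivation D -> fder D a%:F = (D a)%:F.
Proof. by move=> /frac_derP[]. Qed.

Lemma frac_der_ring_derivation D : derivation D ->
  ring_derivation (fder D : R -> R).
Proof.
move=> /frac_derP[[lin DM] _]; split=> // a b.
have := lin (-1) b a; rewrite !scaleN1r => e.
by rewrite addrC e addrC.
Qed.

Lemma frac_der_bracket D E : derivation D -> derivation E ->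
  fder (dbracket D E) = dbracket (fder D : R -> R) (fder E).
Proof.
move=> dD dE; apply/esym/frac_der_unique; last first.
  move=> a; rewrite /dbracket !frac_der_tofrac //.
  by rewrite tofracB.
have [[Dlin DM] _] := frac_derP dD; have [[Elin EM] _] := frac_derP dE.
split=> [c r s|r s]; rewrite /dbracket.
  by rewrite Elin Dlin Elin Dlin scalerBr opprD addrACA.
have DD a b := ring_derivationD a b (frac_der_ring_derivation dD).
have ED a b := ring_derivationD a b (frac_der_ring_derivation dE).
rewrite EM DM DD ED !DM !EM; ring.
Qed.

Lemma frac_der_inj D : derivation D -> fder D = 0 -> D = 0.
Proof.
move=> dD D0; apply/funext => a; apply/eqP.
by rewrite -tofrac_eq0 -frac_der_tofrac // D0.
Qed.

Let M : set (R -> R) := [set fder D | D in L].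

Lemma derived_ring_frac j :
  derived_ring (@dbracket R) M j = [set fder D | D in derived_series L j].
Proof.
rewrite derived_seriesE.
apply: (derived_ring_image _ subalgebra_lie_ring frac_derB) => D E.
by move=> /L_der dD /L_der; exact: frac_der_bracket.
Qed.

Lemma fder0 : fder 0 = 0.
Proof. by have := frac_derB 0 0; rewrite !subrr. Qed.

Lemma derived_ring_frac_eq0 j :
  derived_ring (@dbracket R) M j = [set 0] <-> derived_series L j = [set 0].
Proof.
rewrite derived_ring_frac; split=> [M0|->]; last by rewrite image_set1 fder0.
have lL := subalgebra_lie_ring; rewrite derived_seriesE in M0 *.
apply/seteqP; split=> [D jD|_ ->]; last exact: (derived_ring_subgroup lL j).1.
apply: frac_der_inj; first exact/L_der/(derived_ring_sub lL jD).
suff : [set 0] (fder D : R -> R) by [].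
by rewrite -M0; exists D.
Qed.

Section InCoordinates.
Variables (n : nat) (xA : 'I_n -> A) (dA : 'I_n -> A -> A).
Hypothesis dA_der : forall i, derivation (dA i).
Hypothesis dA_x : forall i j, dA i (xA j) = (i == j)%:R.
Hypothesis L_coord : forall D, L D ->
  exists f : 'I_n -> A, D = fun a => \sum_(i < n) f i * dA i a.

Let x (j : 'I_n) : R := (xA j)%:F.
Let d (i : 'I_n) : R -> R := fder (dA i).

Lemma frac_lie_ring : lie_ring (@dbracket R) M.
Proof.
apply: image_lie_ring subalgebra_lie_ring frac_derB _ => D E /L_der dD /L_der.
exact: frac_der_bracket.
Qed.

Lemma frac_image_derivation : M `<=` @ring_derivation R.
Proof. by move=> _ [D /L_der dD <-]; exact: frac_der_ring_derivation. Qed.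

(** The two sides are derivations that agree on A, and the coefficients of D are
    its values at the coordinates. *)
Lemma frac_image_der X : M X -> forall a, X a = der d (ev x X) a.
Proof.
move=> [D LD <-] a; have dD := L_der LD; have [f DE] := L_coord LD.
have evE i : ev x (fder D) 0 i = (f i)%:F.
  rewrite mxE frac_der_tofrac // DE (bigD1 i) //= dA_x eqxx mulr1.
  by rewrite big1 ?addr0 // => j /negPf ji; rewrite dA_x ji mulr0.
suff fderE : fder D = fun r => \sum_i (f i)%:F * d i r.
  by rewrite {1}fderE; apply: eq_bigr => i _; rewrite evE.
apply/esym/frac_der_unique; last first.
  move=> b; rewrite DE rmorph_sum; apply: eq_bigr => i _.
  by rewrite /d frac_der_tofrac // rmorphM.
have dlin i := (frac_derP (dA_der i)).1.
split=> [c r s|r s].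
  rewrite scaler_sumr -big_split; apply: eq_bigr => i _.
  by rewrite /d (dlin i).1 mulrDr /=; congr (_ + _); exact: mulrCA.
rewrite mulr_suml mulr_sumr -big_split; apply: eq_bigr => i _.
by rewrite /d (dlin i).2 /=; ring.
Qed.

Lemma nilpotent_subalgebra : lie_nilpotent L ->
  finite_dim_over (constants L) (constant_span L)
  /\ exists2 s, is_derived_length L s & (s <= n)%N.
Proof.
move=> [N LN].
pose G i : set (R -> R) := [set fder D | D in lower_central_series L i].
have GM i : G i `<=` M.
  by move=> _ [D GD <-]; exists D => //; exact: lower_central_series_sub GD.
have G_br i X Y : M X -> G i Y -> G i.+1 (dbracket X Y).
  move=> [D LD <-] [E GE <-]; exists (dbracket D E).
    by apply: (span_over_gen setT_subfield); exists D => //; exists E.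
  apply: frac_der_bracket; first exact: L_der.
  by apply: L_der; exact: lower_central_series_sub GE.
have GN : G N = [set 0].
  by rewrite /G LN image_set1 fder0.
have main := (nilpotent_derivations_finite_dim frac_lie_ring
  frac_image_derivation frac_image_der (G := G) erefl GM G_br GN,
  nilpotent_derivations_derived_length frac_lie_ring
  frac_image_derivation frac_image_der (G := G) erefl GM G_br GN).
split; last by apply/exists_derived_length/derived_ring_frac_eq0; exact: main.2.
rewrite /constant_span (_ : constants L = common_constants M).
  exact: main.1.
apply/seteqP; split=> [r Lr _ [D LD <-]|r Mr D LD]; first exact: Lr.
by apply: Mr; exists D.
Qed.

Lemma solvable_subalgebra : lie_solvable L -> [pchar K] =i pred0 ->
  exists2 s, is_derived_length L s & (s <= 2 * n)%N.
Proof.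
move=> [N LN] K0.
have R0 : [pchar R] =i pred0.
  move=> p; rewrite -(K0 p) !inE; congr (_ && _).
  have -> : p%:R = ((p%:R : K)%:A)%:F :> R.
    by rewrite scaler_nat rmorph_nat.
  by rewrite tofrac_eq0 scaler_eq0 oner_eq0 orbF.
apply/exists_derived_length/derived_ring_frac_eq0.
apply: (solvable_derivations_derived_length frac_lie_ring
  frac_image_derivation frac_image_der R0 (N := N)).
exact/derived_ring_frac_eq0.
Qed.

End InCoordinates.
End Subalgebras.

(** * Coordinates of the four algebras *)

Definition mps_var (K : fieldType) n (j : 'I_n) : mpseries n K :=
  MPSeries (fun m => (m == U_(j)%MM)%:R).

Definition coordinate (K : fieldType) n (t : algebra_kind) (j : 'I_n) :
    algebra K n t :=
  match t with
  | Polynomials => 'X_j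
  | PowerSeries => mps_var K j
  | RationalFunctions => ('X_j : {mpoly K[n]})%:F
  | LaurentFractions => (mps_var K j)%:F
  end.

Lemma partial_coordinate (K : fieldType) n t (i j : 'I_n) :
  partial i (coordinate K t j) = (i == j)%:R.
Proof.
have mderivU : mderiv i ('X_j : {mpoly K[n]}) = (i == j)%:R.
  rewrite mderivX mnm1E eq_sym; case: eqVneq => [->|_]; last by rewrite scale0r.
  rewrite scale1r (_ : (U_(j) - U_(j))%MM = 0%MM) ?mpolyX0 //.
  by apply/mnmP => l; rewrite mnmBE mnm0E subnn.
have mps_derivU : mps_deriv i (mps_var K j) = (i == j)%:R.
  apply: mpseriesP => m /=; case: (eqVneq i j) => [->|ij] /=.
    have -> : (m + U_(j) == U_(j))%MM = (m == 0%MM).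
      by rewrite -[X in _ == X]add0m eqm_add2r.
    by case: eqP => [->|_]; rewrite ?mnm0E // mul0rn.
  case: eqP => [/mnmP/(_ i)|_]; last by rewrite mul0rn.
  by rewrite mnmDE !mnm1E eqxx eq_sym (negPf ij) addn1.
have fracU (A : idomainAlgType K) (D : A -> A) a : derivation D ->
    D a = (i == j)%:R -> frac_der D a%:F = (i == j)%:R.
  by move=> dD Da; rewrite frac_der_tofrac // Da rmorph_nat.
case: t => //=; apply: fracU => //; last exact: mps_derivP.
exact: (@partial_derivation K n Polynomials i).
Qed.

Theorem corollary2 (K : fieldType) (n : nat) (t : algebra_kind)
    (L : set (algebra K n t -> algebra K n t))
    (L_subalgebra : lie_subalgebra L)
    (L_der : L `<=` @coord_derivations K n t) :
  (lie_nilpotent L ->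
     finite_dim_over (constants L) (constant_span L)
     /\ exists2 s, is_derived_length L s & (s <= n)%N)
  /\
  (lie_solvable L -> [pchar K] =i pred0 ->
     exists2 s, is_derived_length L s & (s <= 2 * n)%N).
Proof.
have pc i j := @partial_coordinate K n t i j.
have LD D : L D -> derivation D by case/L_der.
have LC D : L D -> exists f, D = fun a => \sum_(i < n) f i * partial i a.
  by case/L_der.
have dp i := @partial_derivation K n t i.
split; first exact: (nilpotent_subalgebra L_subalgebra LD dp pc LC).
exact: (solvable_subalgebra L_subalgebra LD dp pc LC).
Qed.
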